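(* Let $H:\mathcal{P}_1(\mathbb{R})\times\mathbb{R}\to\mathbb{R}$ be of class $C^{0,1}$ and assume that for every $K>0$: (i) $H$ is of class $C^{1,1}$ on $\mathcal{P}([-K,K])\times[-K,K]$; (ii) for all $m\in\mathcal{P}([-K,K])$, $\int_{\mathbb{R}} H(m,x)\,dm(x)=0$; (iii) for all $m\in\mathcal{P}([-K,K])$ and $x,y\in[-K,K]$, $$\delta H_x(m,y)-H(m,x)=\delta H_y(m,x)-H(m,y).$$ Then the function $$F:m\in\mathcal{P}_1(\mathbb{R})\longmapsto \int_0^1\int_{\mathbb{R}} H(t\,m+(1-t)\delta_0,x)\,d(m-\delta_0)(x)\,dt$$ is differentiable on $\mathcal{P}_1(\mathbb{R})$ and, for all $m\in\mathcal{P}_1(\mathbb{R})$ and $x\in\mathbb{R}$, $$\delta F(m,x)=H(m,x).$$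
   Context: $\mathcal{P}_1(\mathbb{R})$ is the space of probability measures on $\mathbb{R}$ with finite first moment, endowed with the Wasserstein metric $W_1$ of order one. For $K>0$, $\mathcal{P}([-K,K])\subseteq\mathcal{P}_1(\mathbb{R})$ is the subspace of measures supported in $[-K,K]$. $\delta_x$ denotes the Dirac mass at $x$. For $G:\mathcal{P}_1(\mathbb{R})\times\mathbb{R}\to\mathbb{R}$ and $x\in\mathbb{R}$, $G_x:m\mapsto G(m,x)$. Differentiability (linear functional derivative): $F:\mathcal{P}_1(\mathbb{R})\to\mathbb{R}$ is differentiable if there is $H:\mathcal{P}_1(\mathbb{R})\times\mathbb{R}\to\mathbb{R}$, measurable and sublinear in the real variable uniformly over the measure variable in any given compact subset of $\mathcal{P}_1(\mathbb{R})$ (i.e. for each compact $\mathcal{K}\subseteq\mathcal{P}_1(\mathbb{R})$ there is $C>0$ with $|H(m,x)|\le C(1+|x|)$ for all $m\in\mathcal{K}$, $x\in\mathbb{R}$), such that for all $m,m_0\in\mathcal{P}_1(\mathbb{R})$, $$F(m)-F(m_0)=\int_0^1\int_{\mathbb{R}}H((1-t)m_0+t\,m,x)\,d(m-m_0)(x)\,dt.$$ Such an $H$ is called a version of the derivative of $F$. The canonical derivative, denoted $\delta F$, is the version satisfying in addition $\int_{\mathbb{R}}H(\mu,x)\,d\mu(x)=0$ for all $\mu\in\mathcal{P}_1(\mathbb{R})$. Thus ''$F$ is differentiable with $\delta F=H$'' means that $H$ is a version of the derivative of $F$ satisfying this canonical condition. Class $C^{0,1}$: $G:\mathcal{P}_1(\mathbb{R})\times\mathbb{R}\to\mathbb{R}$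 is $C^{0,1}$ if it is $C^1$ in $x$ for fixed $m$, continuous in $m$ for fixed $x$, sublinear in $x$ uniformly over $m$ in any compact set, and $(m,x)\mapsto\partial_xG(m,x)$ is jointly continuous. Class $C^1$: $F:\mathcal{P}_1(\mathbb{R})\to\mathbb{R}$ is $C^1$ if it is differentiable and $\delta F$ is $C^{0,1}$. Class $C^{1,1}$: $G:\mathcal{P}_1(\mathbb{R})\times\mathbb{R}\to\mathbb{R}$ is $C^{1,1}$ if it is $C^1$ in $x$ for fixed $m$, $C^1$ in $m$ for fixed $x$ (i.e. $G_x$ is $C^1$), and the functions $(m,x)\mapsto\partial_xG(m,x)$, $(m,x,y)\mapsto\partial_x\delta G_x(m,y)$ and $(m,x,y)\mapsto\partial_y\delta G_x(m,y)$ are jointly continuous. Here $\delta G_x(m,y)$ is the canonical derivative of $G_x$ at $(m,y)$. ''$C^{1,1}$ on $\mathcal{P}([-K,K])\times[-K,K]$'' means that the same definitions hold with $\mathcal{P}_1(\mathbb{R})$ replaced by the convex set $\mathcal{P}([-K,K])$ and $\mathbb{R}$ replaced by $[-K,K]$ (for all measure and real variables involved). *)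

(* Defs.v *)
From HB Require Import structures.
From mathcomp Require Import all_boot all_order all_algebra.
From mathcomp Require Import all_classical all_reals all_analysis measurable_realfun.

Set Implicit Arguments.
Unset Strict Implicit.
Unset Printing Implicit Defensive.
Set SsrOldRewriteGoalsOrder.

Import Order.TTheory GRing.Theory Num.Theory.
Import numFieldNormedType.Exports.

Local Open Scope classical_set_scope.
Local Open Scope ring_scope.

(* A library measure is a function on all sets, constrained only on the
   measurable ones, so two elements of [P1 R] may represent the same measure
   without being equal.  Such elements are at Wasserstein distance 0 and hence
   topologically indistinguishable; a function that is continuous in the
   measure variable does not separate them. *)
Record P1 (R : realType) := MkP1 {
  P1_prob :> probability (measurableTypeR R) R ;
  P1_moment : (\int[P1_prob]_x `|x|%:E < +oo)%E }.

HB.instance Definition _ (R : realType) := gen_eqMixin (P1 R).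
HB.instance Definition _ (R : realType) := gen_choiceMixin (P1 R).

Section wasserstein.
Variable R : realType.
Implicit Types m : P1 R.

Definition coupling m m'
    (pi : probability (measurableTypeR R * measurableTypeR R)%type R) : Prop :=
  forall A : set (measurableTypeR R), measurable A ->
    pi (A `*` setT) = m A /\ pi (setT `*` A) = m' A.

Definition W1 m m' : \bar R :=
  ereal_inf [set (\int[pi]_z `|z.1 - z.2|%:E)%E | pi in coupling m m'].

Definition W1_open : set_system (P1 R) :=
  [set U | forall m, U m ->
     exists2 r : R, 0 < r & [set m' | (W1 m m' < r%:E)%E] `<=` U].

Fact W1_openT : W1_open setT.
Proof. by move=> m _; exists 1. Qed.

Fact W1_openI : setI_closed W1_open.
Proof.
move=> U V oU oV m [/oU[r r0 rU] /oV[s s0 sV]].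
exists (Num.min r s); first by rewrite lt_min r0.
move=> m' /=; rewrite EFin_min lt_min => /andP[mr ms].
by split; [exact: rU|exact: sV].
Qed.

Fact W1_open_bigU (I : Type) (f : I -> set (P1 R)) :
  (forall i, W1_open (f i)) -> W1_open (\bigcup_i f i).
Proof.
move=> of_ m [i _ /of_[r r0 rf]]; exists r => // m' /rf fm'.
by exists i.
Qed.

HB.instance Definition _ :=
  isOpenTopological.Build (P1 R) W1_openT W1_openI W1_open_bigU.

End wasserstein.

Section dirac.
Variables (R : realType) (a : R).

Fact P1_dirac_moment : (\int[@dirac _ (measurableTypeR R) a R]_x `|x|%:E < +oo)%E.
Proof.
rewrite integral_dirac//; first by rewrite diracT mul1e ltry.
by apply/measurable_EFinP; exact: normr_measurable.
Qed.

Definition P1_dirac : P1 R := @MkP1 R (@dirac _ (measurableTypeR R) a R) P1_dirac_moment.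

End dirac.

HB.instance Definition _ (R : realType) := isPointed.Build (P1 R) (P1_dirac 0).

Section mix.
Variables (R : realType) (t : R) (m0 m : P1 R).

(* [t] truncated to [0, 1], so that [mix] is defined for every real [t] *)
Definition clamp01 : R := Num.max 0 (Num.min t 1).

Fact clamp01_ge0 : 0 <= clamp01.
Proof. by rewrite le_max lexx. Qed.

Fact onem_clamp01_ge0 : 0 <= 1 - clamp01.
Proof. by rewrite subr_ge0 ge_max ler01 ge_min lexx orbT. Qed.

Definition mix_measure : set (measurableTypeR R) -> \bar R :=
  measure_add (mscale (NngNum onem_clamp01_ge0) m0)
              (mscale (NngNum clamp01_ge0) m).

HB.instance Definition _ := Measure.on mix_measure.

Fact mix_setT : mix_measure setT = 1%E.
Proof.
rewrite /mix_measure measure_addE.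
rewrite -[LHS]/((1 - clamp01)%:E * m0 setT + clamp01%:E * m setT)%E.
by rewrite 2!probability_setT 2!mule1 -EFinD subrK.
Qed.

HB.instance Definition _ := Measure_isProbability.Build _ _ _ mix_measure mix_setT.

Fact mix_moment : (\int[mix_measure]_x `|x|%:E < +oo)%E.
Proof.
have mn : measurable_fun setT (fun x : measurableTypeR R => `|x|%:E).
  by apply/measurable_EFinP; exact: normr_measurable.
rewrite ge0_integral_measure_add// !ge0_integral_mscale//.
by rewrite lte_add_pinfty// lte_mul_pinfty// P1_moment.
Qed.

(* (1 - t) m0 + t m *)
Definition mix : P1 R := @MkP1 R mix_measure mix_moment.

End mix.

Fact mixE (R : realType) (t : R) (m0 m : P1 R) (A : set R) :
  0 <= t <= 1 -> mix t m0 m A = ((1 - t)%:E * m0 A + t%:E * m A)%E.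
Proof.
move=> /andP[t0 t1]; have tE : clamp01 t = t.
  by rewrite /clamp01 min_l// max_r.
rewrite -[LHS]/(mix_measure t m0 m A) /mix_measure measure_addE.
by rewrite -[LHS]/((1 - clamp01 t)%:E * m0 A + (clamp01 t)%:E * m A)%E tE.
Qed.

Section calculus.
Variable R : realType.

(* derivative along [X]: one-sided at the end points of an interval *)
Definition derivable_within (X : set R) (f : R -> R) (x : R) : Prop :=
  cvg ((fun h => h^-1 *: (f (h + x) - f x)) @ within [set h | X (h + x)] 0^').

Definition derive_within (X : set R) (f : R -> R) (x : R) : R :=
  lim ((fun h => h^-1 *: (f (h + x) - f x)) @ within [set h | X (h + x)] 0^').

Fact derivable_withinT (f : R -> R) (x : R) :
  derivable_within setT f x <-> derivable f x 1.
Proof.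
rewrite /derivable_within /derivable withinET.
suff -> : (fun h => h^-1 *: (f (h + x) - f x)) =
          (fun h => h^-1 *: ((f \o shift x) (h *: 1) - f x)) by [].
by apply/funext => h /=; rewrite [h *: 1]mulr1.
Qed.

Fact derive_withinT (f : R -> R) : derive_within setT f = derive1 f.
Proof. by apply/funext => x; rewrite /derive_within withinET. Qed.

Definition C1_fun (X : set R) (f : R -> R) : Prop :=
  (forall x, X x -> derivable_within X f x) /\
  {within X, continuous (derive_within X f)}.

(* The notions below are relative to a convex set [M] of measures and a set [X]
   of reals: [M = setT] and [X = setT] give P_1(R) and R, [M = supported K] and
   [X = `[-K, K]] give P([-K,K]) and [-K,K].  Values outside [M] and [X] are
   irrelevant. *)
Variables (M : set (P1 R)) (X : set R).
Implicit Types (F : P1 R -> R) (G H : P1 R -> R -> R).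

(* joint measurability, which gives a meaning to the integral in [t] below *)
Definition borel_measurable H : Prop :=
  measurable_fun (M `*` X : set (g_sigma_algebraType (@open (P1 R * R)%type)))
    (fun p => H p.1 p.2).

Definition sublinear H : Prop :=
  forall Q : set (P1 R), compact Q -> Q `<=` M ->
    exists2 C : R, 0 < C &
      forall m x, Q m -> X x -> `|H m x| <= C * (1 + `|x|).

Definition derivative_version F H : Prop :=
  [/\ borel_measurable H,
      sublinear H &
      forall m m0, M m -> M m0 ->
        F m - F m0 =
        \int[lebesgue_measure]_(t in `[0, 1])
          (\int[m]_(x in X) H (mix t m0 m) x -
           \int[m0]_(x in X) H (mix t m0 m) x)].

Definition canonical_derivative F H : Prop :=
  derivative_version F H /\
  forall m, M m -> \int[m]_(x in X) H m x = 0.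

Definition C01 G : Prop :=
  [/\ forall m, M m -> C1_fun X (G m),
      forall x, X x -> {within M, continuous (fun m => G m x)},
      sublinear G &
      {within M `*` X, continuous (fun p => derive_within X (G p.1) p.2)}].

Definition C1 F : Prop := exists H, canonical_derivative F H /\ C01 H.

(* The canonical derivative of a [C1] function.  A [C01] canonical derivative is
   unique on [M `*` X], whereas values of a merely measurable one at extreme
   points of [M] are not determined by [F]. *)
Definition delta F : P1 R -> R -> R :=
  xget (fun _ _ => 0) [set H | canonical_derivative F H /\ C01 H].

Definition C11 G : Prop :=
  [/\ forall m, M m -> C1_fun X (G m),
      forall x, X x -> C1 (G^~ x),
      {within M `*` X, continuous (fun p => derive_within X (G p.1) p.2)},
      (forall m x y, M m -> X x -> X y ->
         derivable_within X (fun x' => delta (G^~ x') m y) x) /\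
      {within M `*` X `*` X, continuous (fun p : P1 R * R * R =>
         derive_within X (fun x => delta (G^~ x) p.1.1 p.2) p.1.2)} &
      {within M `*` X `*` X, continuous (fun p : P1 R * R * R =>
         derive_within X (delta (G^~ p.1.2) p.1.1) p.2)}].

End calculus.

Definition supported (R : realType) (K : R) : set (P1 R) :=
  [set m : P1 R | m [set` `[- K, K]] = 1%E].

(* Main.v *)
(* View [m |-> H m] as a one-form on the space of measures.  Hypothesis (iii)
   says that it is closed: its derivative is symmetric up to a term that vanishes
   on differences of probability measures.  For [p], [q] in P([-K, K]), the
   triangle with vertices [delta_0], [p], [q] is parametrised in polar
   coordinates around [delta_0] by
   [nu u t = (1 - u) delta_0 + u ((1 - t) p + t q)], and the Poincare lemma shows
   that the integral of the form along the segment from [p] to [q] is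
   [F q - F p].  In general, push [p] and [q] forward to [-1/s, 1/s] and let [s]
   tend to 0: the measures met in this limit form a compact set, so that the
   sublinear growth of [H] on it dominates all integrals. *)

Require Import Defs.
From HB Require Import structures.
From mathcomp Require Import all_boot all_order all_algebra.
From mathcomp Require Import all_classical all_reals all_analysis measurable_realfun.
From mathcomp Require Import ring lra.

Set Implicit Arguments.
Unset Strict Implicit.
Unset Printing Implicit Defensive.
Set SsrOldRewriteGoalsOrder.

Import Order.TTheory GRing.Theory Num.Theory.
Import numFieldNormedType.Exports.

Local Open Scope classical_set_scope.
Local Open Scope ring_scope.

(** Hypothesis (i) gives the derivative of [H] in the measure only through an increment formula,
    integrated along segments of measures. The derivatives entering the Poincare lemma are therefore
    recovered as limits of averaged slopes. This asks for a kernel [delta (H^~ x) m y] that is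
    jointly continuous in [(m, x, y)], whereas the class only provides continuity in [m] and joint
    continuity of the partial derivatives in [x] and [y]. In the passage to the limit, all measures
    met must stay in one compact set, since the growth of [H] is controlled on compact sets. The map
    [squash s] is built for this: it is jointly continuous in [(s, x)], it does not increase
    absolute values, so that first moments dominate, and it fixes 0, so that the base point stays in
    place. Mixtures of push-forwards are then continuous in the parameters, and a rectangle of
    parameters has a compact image. Two descriptions of one measure agree only on measurable sets;
    [same_law] and continuity in the measure identify them. *)

(** * Continuity of compositions, pairs and slices *)

Section within_continuity.
Variables (T U V : topologicalType).

Lemma within_comp (A : set T) (B : set U) (f : U -> V) (g : T -> U) :
  (forall t, A t -> B (g t)) -> continuous g -> {within B, continuous f} ->
  {within A, continuous (fun t => f (g t))}.
Proof.
move=> AB cg /subspace_continuousP cf; apply/subspace_continuousP => t At W nW.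
have := cg t _ (cf (g t) (AB t At) W nW).
by apply: (@filterS _ (nbhs t)) => s fW As; exact/fW/AB.
Qed.

Lemma within_compT (B : set U) (f : U -> V) (g : T -> U) :
  (forall t, B (g t)) -> continuous g -> {within B, continuous f} ->
  continuous (fun t => f (g t)).
Proof.
move=> Bg cg /subspace_continuousP cf t W nW.
have := cg t _ (cf (g t) (Bg t) W nW).
by apply: (@filterS _ (nbhs t)) => s; exact.
Qed.

Lemma continuous_pair (f : T -> U) (g : T -> V) :
  continuous f -> continuous g -> continuous (fun t => (f t, g t)).
Proof. by move=> cf cg t; exact: (cvg_pair (cf t) (cg t)). Qed.

Lemma continuousT_comp (f : T -> U) (g : U -> V) :
  continuous f -> continuous g -> continuous (fun t => g (f t)).
Proof. by move=> cf cg t; exact: (continuous_comp (cf t) (cg (f t))). Qed.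

Lemma continuousT_fst : continuous (@fst T U).
Proof. by move=> z; exact: cvg_fst. Qed.

Lemma continuousT_snd : continuous (@snd T U).
Proof. by move=> z; exact: cvg_snd. Qed.

Lemma continuousT_cst (v : V) : continuous (fun _ : T => v).
Proof. by move=> t; exact: cst_continuous. Qed.

Lemma continuousT_id : continuous (fun t : T => t).
Proof. by move=> t; exact: cvg_id. Qed.

End within_continuity.
Arguments continuousT_fst {T U}.
Arguments continuousT_snd {T U}.
Arguments continuousT_id {T}.
Arguments continuousT_cst {T V}.

Lemma continuous_slicel (T U V : topologicalType) (f : T -> U -> V) y :
  continuous (fun z => f z.1 z.2) -> continuous (f^~ y).
Proof.
move=> cf; apply: (continuousT_comp (f := fun x => (x, y)) _ cf).
exact: continuous_pair continuousT_id (continuousT_cst y).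
Qed.

Lemma continuous_slicer (T U V : topologicalType) (f : T -> U -> V) x :
  continuous (fun z => f z.1 z.2) -> continuous (f x).
Proof.
move=> cf; apply: (continuousT_comp (f := fun y => (x, y)) _ cf).
exact: continuous_pair (continuousT_cst x) continuousT_id.
Qed.

Section real_continuity.
Variables (R : realType) (T : topologicalType).
Implicit Types f g : T -> R.

Lemma continuousTD f g : continuous f -> continuous g ->
  continuous (fun t => f t + g t).
Proof. by move=> cf cg t; exact: (cvgD (cf t) (cg t)). Qed.

Lemma continuousTB f g : continuous f -> continuous g ->
  continuous (fun t => f t - g t).
Proof. by move=> cf cg t; exact: (cvgB (cf t) (cg t)). Qed.

Lemma continuousTM f g : continuous f -> continuous g ->
  continuous (fun t => f t * g t).
Proof. by move=> cf cg t; exact: (cvgM (cf t) (cg t)). Qed.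

End real_continuity.

(** * Couplings and the Wasserstein topology *)

Definition same_law (R : realType) (m m' : P1 R) : Prop :=
  forall A : set (measurableTypeR R), measurable A -> m A = m' A.

Section coupling_mixture.
Variables (R : realType) (d : measure_display) (T : measurableType d).
Variables (a b c : {nonneg R}) (abc : a%:num + b%:num + c%:num = 1).
Variables (P1 P2 P3 : probability T R).

(** Mixing couplings lets each part of the mass be transported in its own way. Three parts serve to
    compare two mixtures with different weights: two common parts and one for the discrepancy. *)
Definition mixture3 : set T -> \bar R :=
  measure_add (measure_add (mscale a P1) (mscale b P2)) (mscale c P3).

HB.instance Definition _ := Measure.on mixture3.

Lemma mixture3E A : mixture3 A =
  (a%:num%:E * P1 A + b%:num%:E * P2 A + c%:num%:E * P3 A)%E.
Proof.
rewrite /mixture3 measure_addE; congr (_ + _)%E.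
exact: measure_addE.
Qed.

Lemma mixture3_setT : mixture3 setT = 1%E.
Proof. by rewrite mixture3E !probability_setT !mule1 -!EFinD abc. Qed.

HB.instance Definition _ :=
  Measure_isProbability.Build _ _ _ mixture3 mixture3_setT.

Definition mixture3_prob : probability T R := mixture3.

Lemma ge0_integral_mixture3 (f : T -> \bar R) :
  measurable_fun setT f -> (forall x, 0 <= f x)%E ->
  (\int[mixture3_prob]_x f x =
   a%:num%:E * \int[P1]_x f x + b%:num%:E * \int[P2]_x f x +
   c%:num%:E * \int[P3]_x f x)%E.
Proof.
move=> mf f0; rewrite [LHS]ge0_integral_measure_add// ge0_integral_measure_add//.
by rewrite !ge0_integral_mscale.
Qed.

End coupling_mixture.

Section wasserstein_topology.
Variable R : realType.
Implicit Types m p q : P1 R.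

(* [W1_open] only involves balls around the limit point: the triangle
   inequality for [W1], hence the gluing of couplings, is not needed. *)
Lemma cvg_W1 (T : Type) (F : set_system T) {FF : Filter F} (f : T -> P1 R) m :
  (forall e : R, 0 < e -> \forall t \near F, (W1 m (f t) < e%:E)%E) ->
  f @ F --> m.
Proof.
move=> fm A [B [oB Bm BA]].
have [r r0 rB] := oB m Bm.
by apply: filterS (fm r r0) => t ft; apply/BA/rB.
Qed.

Lemma measurable_dist d (T : measurableType d) (X Y : {mfun T >-> measurableTypeR R}) :
  measurable_fun setT (fun w => `|X w - Y w|%:E : \bar R).
Proof.
apply/measurable_EFinP; apply: measurableT_comp => //.
exact: (measurable_funB (measurable_funPT X) (measurable_funPT Y)).
Qed.

(** The mixture of the joint laws of the pairs [(Xi, Yi)] is a coupling, and its cost is the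
    right-hand side. *)
Lemma W1_le_mixture3 d (T : measurableType d) (P : probability T R)
    (a b c : {nonneg R}) (X1 X2 X3 Y1 Y2 Y3 : {mfun T >-> measurableTypeR R}) m m' :
  a%:num + b%:num + c%:num = 1 ->
  (forall A, measurable A -> m A = a%:num%:E * P (X1 @^-1` A) +
     b%:num%:E * P (X2 @^-1` A) + c%:num%:E * P (X3 @^-1` A))%E ->
  (forall A, measurable A -> m' A = a%:num%:E * P (Y1 @^-1` A) +
     b%:num%:E * P (Y2 @^-1` A) + c%:num%:E * P (Y3 @^-1` A))%E ->
  (W1 m m' <= a%:num%:E * \int[P]_w `|X1 w - Y1 w|%:E +
     b%:num%:E * \int[P]_w `|X2 w - Y2 w|%:E +
     c%:num%:E * \int[P]_w `|X3 w - Y3 w|%:E)%E.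
Proof.
move=> abc mX mY; pose RR := (measurableTypeR R * measurableTypeR R)%type.
pose Z (X Y : {mfun T >-> measurableTypeR R}) : {mfun T >-> RR} :=
  @mfun_Sub _ _ T RR (fun w => (X w, Y w))
    (mem_set (measurable_fun_pair (measurable_funPT X) (measurable_funPT Y))).
pose pi := mixture3_prob abc (distribution P (Z X1 Y1))
  (distribution P (Z X2 Y2)) (distribution P (Z X3 Y3)).
have md : measurable_fun setT (fun z : RR => `|z.1 - z.2|%:E : \bar R).
  by apply/measurable_EFinP; apply: measurableT_comp => //; exact: measurable_funB.
have <- : (\int[pi]_z `|z.1 - z.2|%:E = a%:num%:E * \int[P]_w `|X1 w - Y1 w|%:E +
     b%:num%:E * \int[P]_w `|X2 w - Y2 w|%:E +
     c%:num%:E * \int[P]_w `|X3 w - Y3 w|%:E)%E.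
  by rewrite ge0_integral_mixture3// !ge0_integral_distribution.
apply: ereal_inf_lbound; exists pi => // A mA.
have piE B : pi B = (a%:num%:E * P (Z X1 Y1 @^-1` B) +
    b%:num%:E * P (Z X2 Y2 @^-1` B) + c%:num%:E * P (Z X3 Y3 @^-1` B))%E.
  exact: mixture3E.
have ZX X Y : Z X Y @^-1` (A `*` setT) = X @^-1` A.
  by rewrite eqEsubset; split => w //= [].
have ZY X Y : Z X Y @^-1` (setT `*` A) = Y @^-1` A.
  by rewrite eqEsubset; split => w //= [].
by rewrite !piE !ZX !ZY -mX// -mY.
Qed.

Lemma same_law_W1 m m' : same_law m m' -> W1 m m' = 0%E.
Proof.
move=> mm'; apply/eqP; rewrite eq_le; apply/andP; split; last first.
  by apply: le_ereal_inf_tmp => _ [pi _ <-]; exact: integral_ge0.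
(* The diagonal coupling: weight 1 on the identity paired with itself, weight 0 on the two other
   parts. *)
pose I : {mfun measurableTypeR R >-> measurableTypeR R} :=
  mfun_Sub (mem_set (@measurable_id _ (measurableTypeR R) setT)).
have := @W1_le_mixture3 _ _ m (NngNum ler01) (NngNum (lexx 0))
  (NngNum (lexx 0)) I I I I I I m m'.
under eq_integral do rewrite subrr normr0.
rewrite integral0 !mule0 !adde0; apply=> /=; first by rewrite !addr0.
  by move=> A mA; rewrite mul1e !mul0e !adde0.
by move=> A mA; rewrite mul1e !mul0e !adde0 -mm'.
Qed.

(** By [same_law_W1], [m'] lies in every neighbourhood of [m], and a continuous function into a
    Hausdorff space cannot separate such points. *)
Lemma same_law_within (M : set (P1 R)) (f : P1 R -> R) m m' :
  M m -> M m' -> {within M, continuous f} -> same_law m m' -> f m = f m'.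
Proof.
move=> Mm Mm' cf mm'; apply/esym.
have nm' A : nbhs m A -> A m'.
  have cm' : (fun=> m') @ globally [set: unit] --> m.
    by apply: cvg_W1 => e e0 t _; rewrite same_law_W1.
  by move=> /cm' /(_ tt); apply.
move/subspace_continuousP : cf => /(_ m Mm) fm.
apply/eqP/negPn/negP => /eqP f'm.
have := @Rhausdorff R (f m') (f m).
move=> hd; apply: f'm; apply: hd => A B nA nB.
exists (f m'); split; first exact: nbhs_singleton.
exact: (nm' _ (fm _ nB)).
Qed.

Lemma same_law_continuous (f : P1 R -> R) m m' :
  continuous f -> same_law m m' -> f m = f m'.
Proof.
by move=> cf; apply: (@same_law_within setT) => //; exact: continuous_subspaceT.
Qed.

End wasserstein_topology.

(** * Push-forward to bounded intervals *)

Section squash.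
Variable R : realType.
Implicit Types (s x t : R) (p q : P1 R).

(* [squash s] maps R into [-1/s, 1/s]; at [s = 0] it is the identity.  The
   absolute value makes it continuous in [s] on all of R. *)
Definition squash s x : R := x / (1 + `|s| * `|x|).

Lemma squash_den_gt0 s x : 0 < 1 + `|s| * `|x|.
Proof. by rewrite ltr_pwDl// mulr_ge0. Qed.

Lemma squash0 x : squash 0 x = x.
Proof. by rewrite /squash normr0 mul0r addr0 divr1. Qed.

Lemma squash_at0 s : squash s 0 = 0.
Proof. by rewrite /squash mul0r. Qed.

Lemma norm_squash_le s x : `|squash s x| <= `|x|.
Proof.
rewrite /squash normrM normfV (gtr0_norm (squash_den_gt0 s x)).
by rewrite ler_pdivrMr ?squash_den_gt0// ler_peMr// lerDl mulr_ge0.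
Qed.

Lemma norm_squash_le_inv s x : 0 < s -> `|squash s x| <= s^-1.
Proof.
move=> s0; rewrite /squash normrM normfV (gtr0_norm (squash_den_gt0 s x)).
rewrite ler_pdivrMr ?squash_den_gt0// mulrDr mulr1 (gtr0_norm s0).
by rewrite mulrA mulVf ?gt_eqF// mul1r lerDr invr_ge0 ltW.
Qed.

Lemma squash_continuous : continuous (fun z : R * R => squash z.1 z.2).
Proof.
have cn : continuous (Num.norm : R -> R) by exact: norm_continuous.
have cd : continuous (fun z : R * R => 1 + `|z.1| * `|z.2|).
  apply: continuousTD; first exact: continuousT_cst.
  apply: continuousTM; first exact: (continuousT_comp continuousT_fst cn).
  exact: (continuousT_comp continuousT_snd cn).
apply: continuousTM; first exact: continuousT_snd.
by move=> z; apply: cvgV; [rewrite gt_eqF// squash_den_gt0|exact: cd].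
Qed.

Lemma squash_continuousr s : continuous (squash s).
Proof. exact: continuous_slicer squash_continuous. Qed.

Lemma squash_continuousl x : continuous (squash^~ x).
Proof. exact: continuous_slicel squash_continuous. Qed.

Lemma measurable_squash s :
  measurable_fun setT (squash s : measurableTypeR R -> measurableTypeR R).
Proof. by apply: continuous_measurable_fun; exact: squash_continuousr. Qed.

Definition squash_mfun s : {mfun measurableTypeR R >-> measurableTypeR R} :=
  @mfun_Sub _ _ (measurableTypeR R) (measurableTypeR R) (squash s)
    (mem_set (measurable_squash s)).

Fact push_moment s p :
  (\int[distribution p (squash_mfun s)]_x `|x|%:E < +oo)%E.
Proof.
rewrite ge0_integral_distribution//; last first.
  by apply/measurable_EFinP; exact: normr_measurable.
apply: le_lt_trans (P1_moment p); apply: ge0_le_integral => //=.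
- apply/measurable_EFinP; apply: measurableT_comp => //.
  exact: measurable_squash.
- by apply/measurable_EFinP; exact: normr_measurable.
- by move=> x _; rewrite lee_fin norm_squash_le.
Qed.

Definition push s p : P1 R := MkP1 (push_moment s p).

Lemma pushE s p A : push s p A = p (squash s @^-1` A).
Proof. by []. Qed.

End squash.

(** * Continuity of mixtures in their parameters *)

Section mixture_of_measures.
Variable R : realType.
Implicit Types (s x t : R) (p q : P1 R) (A : set (measurableTypeR R)).

Lemma clamp01_le1 t : clamp01 t <= 1.
Proof. by rewrite ge_max ler01 ge_min lexx orbT. Qed.

Lemma clamp01_id t : 0 <= t <= 1 -> clamp01 t = t.
Proof. by move=> /andP[t0 t1]; rewrite /clamp01 min_l// max_r. Qed.

Lemma mix_clampE t p q A :
  mix t p q A = ((1 - clamp01 t)%:E * p A + (clamp01 t)%:E * q A)%E.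
Proof. exact: measure_addE. Qed.

Lemma clamp01_continuous : continuous (@clamp01 R).
Proof.
move=> t; apply: (@continuous_max _ _ (cst 0) (fun t => Num.min t 1)).
  exact: cst_continuous.
apply: (@continuous_min _ _ id (cst 1)) => //; exact: cst_continuous.
Qed.

Lemma P1_fin p A : measurable A -> exists r : R, p A = r%:E.
Proof. by move=> mA; exists (fine (p A)); rewrite fineK// fin_num_measure. Qed.

(* The common part of the two mixtures is coupled by [(X, X')] and [(Y, Y')],
   the discrepancy [|t - u|] of the weights by [(X, Y')] or [(Y, X')]. *)
Lemma W1_mix d (T : measurableType d) (P : probability T R)
    (X Y X' Y' : {mfun T >-> measurableTypeR R}) t u p q p' q' :
  (forall A, measurable A -> p A = P (X @^-1` A)) ->
  (forall A, measurable A -> q A = P (Y @^-1` A)) ->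
  (forall A, measurable A -> p' A = P (X' @^-1` A)) ->
  (forall A, measurable A -> q' A = P (Y' @^-1` A)) ->
  (W1 (mix t p q) (mix u p' q') <=
   \int[P]_w `|X w - X' w|%:E + \int[P]_w `|Y w - Y' w|%:E +
   `|clamp01 u - clamp01 t|%:E *
     (\int[P]_w `|X w - Y' w|%:E + \int[P]_w `|Y w - X' w|%:E))%E.
Proof.
move=> pX qY pX' qY'; set v := clamp01 t; set w := clamp01 u.
have [v0 v1 w0 w1] : [/\ 0 <= v, v <= 1, 0 <= w & w <= 1].
  by rewrite !clamp01_ge0 !clamp01_le1.
have a0 : 0 <= 1 - Num.max v w by rewrite subr_ge0 ge_max v1 w1.
have b0 : 0 <= Num.min v w by rewrite le_min v0 w0.
have le1M (r : R) (z : \bar R) : r <= 1 -> (0 <= z)%E -> (r%:E * z <= z)%E.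
  by move=> r1 z0; rewrite -[leRHS]mul1e lee_wpmul2r.
have a1 : 1 - Num.max v w <= 1 by rewrite lerBlDr lerDl le_max v0.
have b1 : Num.min v w <= 1 by rewrite ge_min v1.
have abc : 1 - Num.max v w + Num.min v w + `|w - v| = 1.
  rewrite maxEle minEle; case: (leP v w) => vw.
    by rewrite ger0_norm ?subr_ge0//; ring.
  by rewrite ler0_norm ?subr_le0 ?(ltW vw)//; ring.
have main (X3 Y3 : {mfun T >-> measurableTypeR R}) :
    (forall A, measurable A -> mix t p q A =
       (1 - Num.max v w)%:E * p A + (Num.min v w)%:E * q A +
       `|w - v|%:E * P (X3 @^-1` A))%E ->
    (forall A, measurable A -> mix u p' q' A =
       (1 - Num.max v w)%:E * p' A + (Num.min v w)%:E * q' A +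
       `|w - v|%:E * P (Y3 @^-1` A))%E ->
    (\int[P]_w `|X3 w - Y3 w|%:E <=
      \int[P]_w `|X w - Y' w|%:E + \int[P]_w `|Y w - X' w|%:E)%E ->
  (W1 (mix t p q) (mix u p' q') <=
   \int[P]_w `|X w - X' w|%:E + \int[P]_w `|Y w - Y' w|%:E +
   `|w - v|%:E *
     (\int[P]_w `|X w - Y' w|%:E + \int[P]_w `|Y w - X' w|%:E))%E.
  move=> mX mY XY3.
  have := @W1_le_mixture3 _ _ _ P (NngNum a0) (NngNum b0)
    (NngNum (normr_ge0 (w - v))) X Y X3 X' Y' Y3 (mix t p q) (mix u p' q').
  move=> /(_ abc)/(_ _ _)/le_trans -> //=.
  - by move=> A mA; rewrite mX// pX// qY.
  - by move=> A mA; rewrite mY// pX'// qY'.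
  apply: leeD; first by apply: leeD; apply: le1M => //; apply: integral_ge0.
  by rewrite lee_wpmul2l.
have [vw|wv] := leP v w.
- apply: (main X Y') => [A mA|A mA|]; last by rewrite leeDl// integral_ge0.
  + rewrite mix_clampE -/v -pX// max_r// min_l// ger0_norm ?subr_ge0//.
    have [x ->] := P1_fin p mA; have [y ->] := P1_fin q mA.
    by rewrite -!EFinM -!EFinD; congr EFin; ring.
  + rewrite mix_clampE -/w -qY'// max_r// min_l// ger0_norm ?subr_ge0//.
    have [x ->] := P1_fin p' mA; have [y ->] := P1_fin q' mA.
    by rewrite -!EFinM -!EFinD; congr EFin; ring.
- apply: (main Y X') => [A mA|A mA|]; last by rewrite leeDr// integral_ge0.
  + rewrite mix_clampE -/v -qY// max_l ?(ltW wv)// min_r ?(ltW wv)//.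
    rewrite ler0_norm ?subr_le0 ?(ltW wv)//.
    have [x ->] := P1_fin p mA; have [y ->] := P1_fin q mA.
    by rewrite -!EFinM -!EFinD; congr EFin; ring.
  + rewrite mix_clampE -/w -pX'// max_l ?(ltW wv)// min_r ?(ltW wv)//.
    rewrite ler0_norm ?subr_le0 ?(ltW wv)//.
    have [x ->] := P1_fin p' mA; have [y ->] := P1_fin q' mA.
    by rewrite -!EFinM -!EFinD; congr EFin; ring.
Qed.

Lemma measurable_norm_EFin :
  measurable_fun setT (fun x : measurableTypeR R => `|x|%:E : \bar R).
Proof. by apply/measurable_EFinP; exact: normr_measurable. Qed.

(** All four push-forwards are laws of functions of one independent pair drawn from [p \x q], so
    that [W1_mix] applies. The factor 2 counts its two cross terms, each at most [|x| + |y|] because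
    squashing does not increase absolute values. *)
Lemma W1_mix_push s s' t u p q :
  (W1 (mix t (push s p) (push s q)) (mix u (push s' p) (push s' q)) <=
   \int[p]_x `|squash s x - squash s' x|%:E +
   \int[q]_x `|squash s x - squash s' x|%:E +
   (`|clamp01 u - clamp01 t| * 2)%:E *
     (\int[p]_x `|x|%:E + \int[q]_x `|x|%:E))%E.
Proof.
pose RR := (measurableTypeR R * measurableTypeR R)%type.
pose P : probability RR R := (p \x q)%E.
have mfst r : measurable_fun setT (fun z : RR => squash r z.1 : measurableTypeR R).
  by apply: measurableT_comp => //; exact: measurable_squash.
have msnd r : measurable_fun setT (fun z : RR => squash r z.2 : measurableTypeR R).
  by apply: measurableT_comp => //; exact: measurable_squash.
pose X r : {mfun RR >-> measurableTypeR R} :=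
  @mfun_Sub _ _ RR (measurableTypeR R) _ (mem_set (mfst r)).
pose Y r : {mfun RR >-> measurableTypeR R} :=
  @mfun_Sub _ _ RR (measurableTypeR R) _ (mem_set (msnd r)).
have PX r A : measurable A -> push r p A = P (X r @^-1` A).
  move=> mA; have mB : measurable (squash r @^-1` A : set (measurableTypeR R)).
    by rewrite -[X in measurable X]setTI; exact: measurable_squash.
  rewrite [X r @^-1` A](_ : _ = (squash r @^-1` A) `*` setT); last first.
    by rewrite eqEsubset; split => z //= [].
  transitivity (p (squash r @^-1` A) * q setT)%E; last by rewrite -product_measure1E.
  by rewrite probability_setT mule1.
have PY r A : measurable A -> push r q A = P (Y r @^-1` A).
  move=> mA; have mB : measurable (squash r @^-1` A : set (measurableTypeR R)).
    by rewrite -[X in measurable X]setTI; exact: measurable_squash.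
  rewrite [Y r @^-1` A](_ : _ = setT `*` (squash r @^-1` A)); last first.
    by rewrite eqEsubset; split => z //= [].
  transitivity (p setT * q (squash r @^-1` A))%E; last by rewrite -product_measure1E.
  by rewrite probability_setT mul1e.
have intX (f : measurableTypeR R -> \bar R) : measurable_fun setT f ->
    (forall x, 0 <= f x)%E -> (\int[P]_z f z.1 = \int[p]_x f x)%E.
  move=> mf f0; rewrite [LHS]fubini_tonelli1//; last exact: measurableT_comp.
  apply: eq_integral => x _; rewrite /fubini_F/=.
  transitivity (f x * q setT)%E; first exact: integral_cst.
  by rewrite probability_setT mule1.
have intY (f : measurableTypeR R -> \bar R) : measurable_fun setT f ->
    (forall x, 0 <= f x)%E -> (\int[P]_z f z.2 = \int[q]_x f x)%E.
  move=> mf f0; rewrite [LHS]fubini_tonelli1//; last exact: measurableT_comp.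
  rewrite (eq_integral (fun=> \int[q]_y f y)%E)//.
  transitivity ((\int[q]_y f y) * p setT)%E; first exact: integral_cst.
  by rewrite probability_setT mule1.
have mn := measurable_norm_EFin.
have cross (X3 Y3 : {mfun RR >-> measurableTypeR R}) :
    (forall z, `|X3 z - Y3 z| <= `|z.1| + `|z.2|) ->
    (\int[P]_z `|X3 z - Y3 z|%:E <= \int[p]_x `|x|%:E + \int[q]_x `|x|%:E)%E.
  move=> XY3; rewrite -intX// -intY// -ge0_integralD//; last 2 first.
  - by apply: (measurableT_comp mn).
  - by apply: (measurableT_comp mn).
  apply: ge0_le_integral => //.
  - exact: measurable_dist.
  - by apply: emeasurable_funD; apply: (measurableT_comp mn).
  - by move=> z _; rewrite -EFinD lee_fin.
have dX : (\int[P]_z `|X s z - X s' z|%:E =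
    \int[p]_x `|squash s x - squash s' x|%:E)%E.
  apply: (intX (fun x => `|squash s x - squash s' x|%:E)) => //.
  exact: (measurable_dist (squash_mfun s) (squash_mfun s')).
have dY : (\int[P]_z `|Y s z - Y s' z|%:E =
    \int[q]_x `|squash s x - squash s' x|%:E)%E.
  apply: (intY (fun x => `|squash s x - squash s' x|%:E)) => //.
  exact: (measurable_dist (squash_mfun s) (squash_mfun s')).
apply: le_trans (W1_mix t u (PX s) (PY s) (PX s') (PY s')) _.
rewrite dX dY leeD2l// EFinM -muleA lee_wpmul2l//.
rewrite -[(2%:R)%:E]/((1 + 1)%:E) EFinD ge0_muleDl// mul1e leeD//; apply: cross => z /=.
- by rewrite (le_trans (ler_normB _ _))// lerD// norm_squash_le.
- by rewrite (le_trans (ler_normB _ _))// addrC lerD// norm_squash_le.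
Qed.

(** [W1_mix] on the space of an arbitrary coupling of [p] and [q], with the constant 0 for the Dirac
    mass, followed by the infimum over couplings. The error term is finite, so it can be moved
    across to isolate this infimum. *)
Lemma W1_mix_dirac t u p q :
  (W1 (mix t (P1_dirac 0%R) p) (mix u (P1_dirac 0%R) q) <=
   W1 p q +
   `|clamp01 u - clamp01 t|%:E * (\int[p]_x `|x|%:E + \int[q]_x `|x|%:E))%E.
Proof.
set M := (_ * _)%E; have Mfin : M \is a fin_num.
  rewrite fin_numM// fin_numD !ge0_fin_numE ?P1_moment//; exact: integral_ge0.
rewrite -leeBlDr//; apply: le_ereal_inf_tmp => _ [pi pq <-]; rewrite leeBlDr//.
pose RR := (measurableTypeR R * measurableTypeR R)%type.
pose X : {mfun RR >-> measurableTypeR R} := 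
  @mfun_Sub _ _ RR (measurableTypeR R) (cst 0) (mem_set (measurable_cst _)).
pose Y : {mfun RR >-> measurableTypeR R} :=
  @mfun_Sub _ _ RR (measurableTypeR R) _ (mem_set measurable_fst).
pose Y' : {mfun RR >-> measurableTypeR R} :=
  @mfun_Sub _ _ RR (measurableTypeR R) _ (mem_set measurable_snd).
have XE A : measurable A -> P1_dirac 0%R A = pi (X @^-1` A).
  move=> mA; rewrite /= diracE preimage_cst.
  by case: ifPn => _; rewrite ?measure0 ?probability_setT.
have YE A : measurable A -> p A = pi (Y @^-1` A).
  move=> mA; rewrite -(pq A mA).1; congr (pi _).
  by rewrite eqEsubset; split => z //= [].
have YE' A : measurable A -> q A = pi (Y' @^-1` A).
  move=> mA; rewrite -(pq A mA).2; congr (pi _).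
  by rewrite eqEsubset; split => z //= [].
apply: le_trans (W1_mix t u XE YE XE YE') _.
rewrite /= subrr normr0 integral0 add0e leeD2l// lee_wpmul2l//.
under eq_integral do rewrite sub0r normrN.
under [X in (_ + X <= _)%E]eq_integral do rewrite subr0.
have mn := measurable_norm_EFin.
rewrite addeC leeD//.
- rewrite (eq_measure_integral (distribution pi Y)); last by move=> A mA _; exact: YE.
  by rewrite ge0_integral_distribution.
- rewrite (eq_measure_integral (distribution pi Y')); last by move=> A mA _; exact: YE'.
  by rewrite ge0_integral_distribution.
Qed.

Lemma integrable_norm p : p.-integrable setT (fun x : measurableTypeR R => `|x|%:E).
Proof.
apply/integrableP; split; first by apply/measurable_EFinP; exact: normr_measurable.
under eq_integral do rewrite /= normr_id.
exact: P1_moment.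
Qed.

Lemma integrable_squash_dist p s s' :
  p.-integrable setT (fun x : measurableTypeR R => `|squash s x - squash s' x|%:E).
Proof.
have i2 : p.-integrable setT (fun x : measurableTypeR R => (2 * `|x|)%:E).
  by under eq_fun do rewrite EFinM; apply: integrableZl => //; exact: integrable_norm.
apply: le_integrable i2 => //=.
  exact: (measurable_dist (squash_mfun s) (squash_mfun s')).
move=> x _; rewrite !lee_fin normr_id (@ger0_norm _ (2 * _)) ?mulr_ge0//.
rewrite (le_trans (ler_normB _ _))// mulr_natl mulr2n.
by rewrite lerD// norm_squash_le.
Qed.

(** Dominated convergence with the majorant [2 * |x|], integrable by the finite first moment. The
    interval []s - 1, s + 1[] is just a neighbourhood of [s]. *)
Lemma squash_dist_cvg p s :
  (\int[p]_x `|squash s x - squash s' x|)%R @[s' --> s] --> (0 : R).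
Proof.
have -> : (0 : R) = \int[p]_x `|squash s x - squash s x|.
  under eq_Rintegral do rewrite subrr normr0.
  by rewrite Rintegral_cst// mul0r.
have I1 : s \in [set` `]s - 1, s + 1[].
  by rewrite inE/= in_itv/=; apply/andP; split; lra.
have i2 : p.-integrable setT (fun x : measurableTypeR R => (2 * `|x|)%:E).
  by under eq_fun do rewrite EFinM; apply: integrableZl => //; exact: integrable_norm.
have bd s' x : `|squash s x - squash s' x| <= 2 * `|x|.
  rewrite (le_trans (ler_normB _ _))// mulr_natl mulr2n.
  by rewrite lerD// norm_squash_le.
apply: (@continuity_under_integral R _ (measurableTypeR R) p
  (fun s' x => `|squash s x - squash s' x|) setT _ (s - 1) (s + 1)
  _ _ (fun x => 2 * `|x|) _ _ s I1) => //.
- by move=> s' _; exact: integrable_squash_dist.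
- apply: aeW => x _ s' _.
  apply: (@continuous_comp _ _ _ (fun s' => squash s x - squash s' x) Num.norm);
    last exact: norm_continuous.
  by apply: continuousB; [exact: cst_continuous|exact: squash_continuousl].
- by move=> s' _; apply: aeW => x _; rewrite /= normr_id bd.
Qed.

(** Continuity in the pair of parameters is what makes the measures of the final limit a compact
    set. *)
Lemma mix_push_continuous p q :
  continuous (fun z : R * R => mix z.2 (push z.1 p) (push z.1 q)).
Proof.
move=> [s t] /=; apply: cvg_W1 => e e0.
pose M := fine (\int[p]_x `|x|%:E + \int[q]_x `|x|%:E)%E.
have ME : (\int[p]_x `|x|%:E + \int[q]_x `|x|%:E = M%:E)%E.
  rewrite /M fineK// fin_numD !ge0_fin_numE; try exact: integral_ge0.
  by rewrite !P1_moment.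
have M0 : 0 <= M by rewrite fine_ge0// adde_ge0//; exact: integral_ge0.
pose r (s' : R) (m : P1 R) := \int[m]_x `|squash s x - squash s' x|.
have rE (m : P1 R) s' : (\int[m]_x `|squash s x - squash s' x|%:E = (r s' m)%:E)%E.
  rewrite /r /Rintegral fineK// ge0_fin_numE; last exact: integral_ge0.
  have [/= _] := integrableP _ _ _ (integrable_squash_dist m s s').
  by under eq_integral do rewrite /= normr_id.
have rcvg (m : P1 R) : r z.1 m @[z --> (s, t)] --> (0 : R).
  apply: (@cvg_comp _ _ _ fst (r^~ m) _ (nbhs s)); first exact: cvg_fst.
  exact: squash_dist_cvg.
have tcvg : `|clamp01 z.2 - clamp01 t| * 2 * M @[z --> (s, t)] --> (0 : R).
  rewrite -(mul0r M); apply: cvgMl; rewrite -(mul0r 2); apply: cvgMl.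
  rewrite -(normr0 R) -(subrr (clamp01 t)).
  apply: cvg_norm.
    apply: cvgB; last exact: cvg_cst.
  apply: (@cvg_comp _ _ _ snd (@clamp01 R) _ (nbhs t)); first exact: cvg_snd.
  exact: clamp01_continuous.
have : r z.1 p + r z.1 q + `|clamp01 z.2 - clamp01 t| * 2 * M @[z --> (s, t)]
    --> (0 + 0 + 0 : R).
  by apply: cvgD tcvg; exact: cvgD (rcvg p) (rcvg q).
rewrite !addr0 => /cvgrPdist_lt/(_ e e0); apply: filterS => -[s' t'] /=.
rewrite sub0r normrN => lte; apply: le_lt_trans (W1_mix_push s s' t t' p q) _.
by rewrite ME !rE -EFinM -!EFinD lte_fin (le_lt_trans (ler_norm _)).
Qed.

Lemma W1_same_law m m' p p' :
  same_law m m' -> same_law p p' -> W1 m p = W1 m' p'.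
Proof.
move=> mm' pp'; congr ereal_inf; congr image; apply/seteqP.
by split => pi mp A mA; rewrite (mp A mA).1 (mp A mA).2 mm'// pp'.
Qed.

Lemma push0 p : same_law (push 0 p) p.
Proof.
move=> A _; rewrite pushE (_ : _ @^-1` _ = A)//.
by apply/seteqP; split => x /=; rewrite squash0.
Qed.

Lemma mix_same_law t p q p' q' :
  same_law p p' -> same_law q q' -> same_law (mix t p q) (mix t p' q').
Proof. by move=> pp' qq' A mA; rewrite !mix_clampE pp'// qq'. Qed.

Lemma mix_moment_le t p q :
  (\int[mix t p q]_x `|x|%:E <= \int[p]_x `|x|%:E + \int[q]_x `|x|%:E)%E.
Proof.
have mn := measurable_norm_EFin.
rewrite [leLHS]ge0_integral_measure_add// !ge0_integral_mscale//.
apply: leeD; rewrite -[leRHS]mul1e lee_wpmul2r ?integral_ge0//= lee_fin.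
  by rewrite lerBlDr lerDl clamp01_ge0.
exact: clamp01_le1.
Qed.

Lemma mix_dirac_continuous p q :
  continuous (fun z : R * R => mix z.1 (P1_dirac 0) (mix z.2 p q)).
Proof.
move=> [u t] /=; apply: cvg_W1 => e e0.
pose M := fine (\int[p]_x `|x|%:E + \int[q]_x `|x|%:E)%E.
have ME : (\int[p]_x `|x|%:E + \int[q]_x `|x|%:E = M%:E)%E.
  rewrite /M fineK// fin_numD !ge0_fin_numE; try exact: integral_ge0.
  by rewrite !P1_moment.
have : `|clamp01 z.2 - clamp01 t| * 2 * M + `|clamp01 z.1 - clamp01 u| * (M + M)
    @[z --> (u, t)] --> (0 * 2 * M + 0 * (M + M) : R).
  apply: cvgD; apply: cvgMl; first apply: cvgMl.
  - rewrite -(normr0 R) -(subrr (clamp01 t)); apply: cvg_norm.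
    apply: cvgB; last exact: cvg_cst.
    apply: (@cvg_comp _ _ _ snd (@clamp01 R) _ (nbhs t)); first exact: cvg_snd.
    exact: clamp01_continuous.
  - rewrite -(normr0 R) -(subrr (clamp01 u)); apply: cvg_norm.
    apply: cvgB; last exact: cvg_cst.
    apply: (@cvg_comp _ _ _ fst (@clamp01 R) _ (nbhs u)); first exact: cvg_fst.
    exact: clamp01_continuous.
rewrite !mul0r addr0 => /cvgrPdist_lt/(_ e e0); apply: filterS => -[u' t'] /=.
rewrite sub0r normrN => lte; apply: le_lt_trans (W1_mix_dirac _ _ _ _) _.
apply: (@le_lt_trans _ _ (`|clamp01 t' - clamp01 t| * 2 * M +
  `|clamp01 u' - clamp01 u| * (M + M))%:E); last first.
  by rewrite lte_fin (le_lt_trans (ler_norm _)).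
rewrite EFinD leeD//.
  (* [push 0] keeps the law, so [W1_mix_push] with [s = s' = 0] bounds the effect of changing the
     weight alone. *)
  have mp0 r : same_law (mix r (push 0 p) (push 0 q)) (mix r p q).
    by apply: mix_same_law; exact: push0.
  rewrite -(W1_same_law (mp0 t) (mp0 t')).
  apply: le_trans (W1_mix_push _ _ _ _ _ _) _.
  under eq_integral do rewrite subrr normr0.
  under [X in (_ + X + _ <= _)%E]eq_integral do rewrite subrr normr0.
  by rewrite !integral0 !add0e ME.
by rewrite EFinM lee_wpmul2l// EFinD -ME leeD// mix_moment_le.
Qed.

End mixture_of_measures.

(** * Derivatives along an interval and joint continuity *)

Section derivative_within.
Variable R : realType.
Implicit Types (X : set R) (f : R -> R) (x : R).

Lemma derivable_within_cvg X f x :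
  derivable_within X f x -> f @ within X (nbhs x) --> f x.
Proof.
rewrite /derivable_within; set F := within _ 0^' => dfx.
have FF : Filter F by exact: within_filter.
have h0 : h @[h --> F] --> (0 : R).
  by apply: cvg_within_filter; apply: cvg_within.
have F_neq0 : \forall h \near F, h != 0.
  by rewrite /F !near_withinE; apply: nearW => h.
have /cvgrPdist_lt fh : f (h + x) - f x @[h --> F] --> (0 : R).
  rewrite -(mul0r (lim ((fun h => h^-1 *: (f (h + x) - f x)) @ F))).
  apply: cvg_trans (cvgM h0 dfx); apply: near_eq_cvg.
  near=> h; have h_neq0 : h != 0 by near: h.
  by rewrite -[LHS]/(h * (h^-1 * (f (h + x) - f x))) mulrA divff// mul1r.
apply/cvgrPdist_lt => e e0; have := fh e e0.
rewrite /F !near_withinE; move=> /nbhs_ballP[d /= d0 dF].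
apply/nbhs_ballP; exists d => //= y xy Xy.
have [->|yx] := eqVneq y x; first by rewrite subrr normr0.
have := dF (y - x); rewrite /= subrK sub0r normrN distrC; apply => //.
  by rewrite /ball/= sub0r normrN distrC.
by rewrite subr_eq0.
Unshelve. all: by end_near. Qed.

(** Near an interior point the constraint [X (h + x)] always holds, so both difference quotients are
    taken along the same filter. *)
Lemma is_derive_within X f x :
  nbhs x X -> derivable_within X f x -> is_derive x 1 f (derive_within X f x).
Proof.
move=> nX; rewrite /derivable_within /derive_within.
have -> : within [set h | X (h + x)] 0^' = 0^'.
  have X0 : \forall h \near (0 : R)^', X (h + x).
    have cx : (h + x) @[h --> (0 : R)] --> x.
      by rewrite -[X in _ --> X]add0r; apply: cvgD; [exact: cvg_id|exact: cvg_cst].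
    by rewrite near_withinE; near=> h => _; near: h; exact: (cx _ nX).
  apply/seteqP; split => A; last by apply: filterS.
  by rewrite /within/= => wA; near=> h; apply: (near wA h) => //; near: h.
have -> : (fun h => h^-1 *: (f (h + x) - f x)) =
   (fun h => h^-1 *: ((f \o shift x) (h *: 1) - f x)).
  by apply/funext => h /=; rewrite [h *: 1]mulr1.
move=> df; have dfx : derivable f x 1 := df.
exact: (DeriveDef dfx erefl).
Unshelve. all: by end_near. Qed.

Lemma MVT_within X f a b : is_interval X -> X a -> X b -> a < b ->
  (forall x, X x -> derivable_within X f x) ->
  exists2 c, c \in `]a, b[ & f b - f a = derive_within X f c * (b - a).
Proof.
move=> iX Xa Xb ab df.
have abX c : c \in `[a, b] -> X c by rewrite in_itv/=; exact: iX.
apply: MVT => //.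
- move=> c cab; apply: is_derive_within.
    apply: (@filterS _ _ _ [set` `]a, b[]); last exact: near_in_itvoo.
    by move=> y yab; apply: abX; exact: subset_itv_oo_cc.
  by apply: df; apply: abX; exact: subset_itv_oo_cc.
- apply/subspace_continuousP => c cab.
  apply: cvg_trans (derivable_within_cvg (df _ (abX _ cab))).
  by apply: cvg_app; apply: within_subset => y; exact: abX.
Qed.

(** The derivative is bounded only at points no farther from [x] than [y]; this allows a bound known
    just on a ball around [x]. *)
Lemma norm_increment_within X f x y (M : R) : is_interval X -> X x -> X y ->
  (forall z, X z -> derivable_within X f z) ->
  (forall z, `|z - x| <= `|y - x| -> X z -> `|derive_within X f z| <= M) ->
  `|f y - f x| <= M * `|y - x|.
Proof.
move=> iX Xx Xy df dM.
have [xy|yx|->] := ltgtP x y; last by rewrite !subrr normr0 mulr0.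
- have [c cxy ->] := MVT_within iX Xx Xy xy df.
  rewrite normrM ler_wpM2r//; move: cxy; rewrite in_itv/= => /andP[xc cy].
  apply: dM; last by apply: (iX x y) => //; rewrite !ltW.
  by rewrite !gtr0_norm ?subr_gt0// lerB// ltW.
- have [c cxy fxy] := MVT_within iX Xy Xx yx df.
  rewrite distrC fxy distrC normrM ler_wpM2r//.
  move: cxy; rewrite in_itv/= => /andP[yc cx].
  apply: dM; last by apply: (iX y x) => //; rewrite !ltW.
  by rewrite !ltr0_norm ?subr_lt0// !opprB lerB// ltW.
Qed.

(** Joint continuity bounds the derivative near [(t0, x0)], by [|D0| + 1] say. Hence [f t] varies
    from its value at [x0] at a linear rate independent of [t], and continuity of [f^~ x0] controls
    the rest. *)
Lemma joint_continuity (T : topologicalType) (A : set T) X (f : T -> R -> R) :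
  is_interval X ->
  (forall x, X x -> {within A, continuous (f^~ x)}) ->
  (forall t x, A t -> X x -> derivable_within X (f t) x) ->
  {within A `*` X, continuous (fun p => derive_within X (f p.1) p.2)} ->
  {within A `*` X, continuous (fun p => f p.1 p.2)}.
Proof.
move=> iX cf df /subspace_continuousP cdf.
apply/subspace_continuousP => -[t0 x0] [/= At0 Xx0].
set D0 := derive_within X (f t0) x0.
have /cvgrPdist_lt/(_ 1 ltr01) := cdf (t0, x0) (conj At0 Xx0).
rewrite near_withinE => -[[U V] /= [nU /nbhs_ballP[d /= d0 dV]] UV].
have bound t x : A t -> X x -> U t -> ball x0 d x ->
    `|f t x - f t x0| <= (`|D0| + 1) * `|x - x0|.
  move=> At Xx Ut xd; apply: norm_increment_within iX Xx0 Xx _ _ => [z Xz|z zx Xz].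
    exact: df.
  have : `|D0 - derive_within X (f t) z| < 1.
    apply: (UV (t, z)) => //; split => //=; apply: dV; rewrite /ball/= distrC.
    by rewrite (le_lt_trans zx)// distrC.
  rewrite distrC => /ltW h.
  by rewrite -[X in `|X|](subrK D0) addrC (le_trans (ler_normD _ _))// lerD2l.
apply/cvgrPdist_lt => e e0.
move/subspace_continuousP : (cf x0 Xx0) => /(_ t0 At0)/cvgrPdist_lt/(_ (e / 2)).
rewrite divr_gt0// near_withinE => /(_ isT) ft.
set M := `|D0| + 1; have M0 : 0 < M by rewrite ltr_wpDl.
rewrite near_withinE.
exists (U `&` [set t | A t -> `|f t0 x0 - f t x0| < e / 2],
  ball x0 (Num.min d (e / 2 / M))).
  split => /=; first exact: filterI.
  by apply: nbhsx_ballx; rewrite lt_min d0 !divr_gt0.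
move=> [t x] /= [[Ut ftx] xb] [At Xx].
have xd : ball x0 d x by apply: le_ball xb; rewrite ge_min lexx.
have xe : `|x - x0| < e / 2 / M.
  by move: xb; rewrite /ball/= distrC lt_min => /andP[].
have := bound t x At Xx Ut xd.
have := ftx At; rewrite -/M => h1 h2.
have h3 : M * `|x - x0| < e / 2 by rewrite mulrC -ltr_pdivlMr.
change (`|f t0 x0 - f t x| < e).
rewrite -(subrK (f t x0) (f t0 x0)) -addrA (le_lt_trans (ler_normD _ _))//.
rewrite [X in _ < X](splitr e) ltrD//.
by rewrite distrC (le_lt_trans h2).
Qed.

End derivative_within.

(** * Continuity of integrals depending on a parameter *)

Section parametric_integral.
Variables (R : realType) (mu : {measure set (measurableTypeR R) -> \bar R}).
Variables (a b : R) (muab : (mu [set` `[a, b]] < +oo)%E).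

Lemma continuous_integrable_itv (f : R -> R) :
  continuous f -> mu.-integrable [set` `[a, b]] (EFin \o f).
Proof.
move=> cf; apply: measurable_bounded_integrable => //.
- by apply: measurable_funTS; exact: continuous_measurable_fun.
- have /compact_bounded[M [_ mrt]] : compact (f @` [set` `[a, b]]).
    apply: continuous_compact; last exact: segment_compact.
    exact: continuous_subspaceT.
  exists M; split; rewrite ?num_real // => ? ? ? ?.
  by apply: mrt => //; exists x.
Qed.

(** Compactness of [[a, b]] makes the local estimates around the points [(t0, x0)] uniform in
    [x]. *)
Lemma tube (T : topologicalType) (f : T -> R -> R) (t0 : T) (e : R) :
  continuous (fun z => f z.1 z.2) -> 0 < e ->
  \forall t \near t0, forall x, x \in `[a, b] -> `|f t x - f t0 x| <= e.
Proof.
move=> cf e0.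
have /compact_near_coveringP/(_ _ (nbhs t0)
  (fun t x => `|f t x - f t0 x| <= e) _) := @segment_compact R a b.
apply=> x0 _; have /cvgrPdist_lt/(_ (e / 2)) := cf (t0, x0).
rewrite divr_gt0// => /(_ isT)[[U V] /= [nU nV] UV].
exists (V, U) => //= -[x t] /= [Vx Ut].
have tx := UV (t, x) (conj Ut Vx).
have t0x := UV (t0, x) (conj (nbhs_singleton nU) Vx).
rewrite -(subrK (f t0 x0) (f t x)) -addrA (le_trans (ler_normD _ _))//.
by rewrite [leRHS]splitr lerD// ltW// distrC.
Qed.

Lemma continuous_Rintegral (T : topologicalType) (f : T -> R -> R) :
  continuous (fun z => f z.1 z.2) ->
  continuous (fun t => \int[mu]_(x in [set` `[a, b]]) f t x).
Proof.
move=> cf t0; have ct t : continuous (f t) by exact: continuous_slicer cf.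
have mab : measurable ([set` `[a, b]] : set (measurableTypeR R)) by [].
have it t := continuous_integrable_itv (ct t).
apply/cvgrPdist_le => e e0; set m := fine (mu [set` `[a, b]]).
have m0 : 0 <= m by exact: fine_ge0.
(* [m + 1] instead of [m], since the segment may have measure 0. *)
have e1 : 0 < e / (m + 1) by rewrite divr_gt0// ltr_wpDl.
apply: filterS (tube t0 cf e1) => t tt0.
rewrite -RintegralB// (le_trans (le_normr_Rintegral _ _))//.
  by apply: continuous_integrable_itv => x; apply: continuousB; exact: ct.
apply: (@le_trans _ _ (\int[mu]_(x in [set` `[a, b]]) (e / (m + 1)))).
  apply: le_Rintegral => //.
  - apply: continuous_integrable_itv => x.
    apply: (@continuous_comp _ _ _ (fun x => f t0 x - f t x) Num.norm).
      by apply: continuousB; exact: ct.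
    exact: norm_continuous.
  - by apply: continuous_integrable_itv => x; exact: cst_continuous.
  - by move=> x xab; rewrite distrC tt0.
rewrite Rintegral_cst// -/m mulrAC ler_pdivrMr ?ltr_wpDl//.
by rewrite ler_wpM2l ?(ltW e0)// lerDl.
Qed.

End parametric_integral.

(** * The Poincare lemma on the unit square *)

Section closed_form.
Variable R : realType.
Notation mu := (@lebesgue_measure R).

Lemma lebesgue01 : (mu [set` `[0%R, 1%R]] < +oo)%E.
Proof. by rewrite lebesgue_measure_itv/= lte_fin ltr01 -EFinB ltry. Qed.

Lemma Rintegral_derive01 (f F : R -> R) : continuous f -> continuous F ->
  (forall x : R, x \in `]0, 1[ -> is_derive x 1 F (f x)) ->
  \int[mu]_(x in `[0, 1]) f x = F 1 - F 0.
Proof.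
move=> cf cF dF; rewrite /Rintegral (@continuous_FTC2 _ f F)//.
- exact: continuous_subspaceT.
- split; [by move=> x /dF df; apply: ex_derive| |].
    by apply: cvg_at_right_filter; exact: cF.
  by apply: cvg_at_left_filter; exact: cF.
- by move=> x /dF df; rewrite derive1E; exact: derive_val.
Qed.

Lemma bounded_on_square (f : R -> R -> R) : continuous (fun z => f z.1 z.2) ->
  exists2 M : R, 0 <= M &
    forall u t : R, u \in `[0, 1] -> t \in `[0, 1] -> `|f u t| <= M.
Proof.
move=> cf; have /compact_bounded[M [_ mrt]] :
    compact ((fun z => f z.1 z.2) @` ([set` `[0, 1]] `*` [set` `[0, 1]])).
  apply: continuous_compact; first exact: continuous_subspaceT.
  by apply: compact_setX; exact: segment_compact.
exists (`|M| + 1) => [|u t u01 t01]; first exact: addr_ge0.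
apply: mrt; first by rewrite (le_lt_trans (ler_norm _))// ltrDl.
by exists (u, t).
Qed.

(** Indices stand for measures, [phi i] for the integral of [H] at [nu u t] against [i], and [c i j]
    for the double integral of its derivative. [phi_t] and [phi_u] are chain rules: [nu] has
    velocity [u (q - p)] in [t] and [(1 - t) p + t q - o] in [u]. [c_sym] is hypothesis (iii)
    integrated against [i] and [j]. *)
Variables (I : Type) (o p q : I).
Variables (phi : I -> R -> R -> R) (c : I -> I -> R -> R -> R).
Hypothesis cphi : forall i, continuous (fun z => phi i z.1 z.2).
Hypothesis cc : forall i j, continuous (fun z => c i j z.1 z.2).
Hypothesis phi_t : forall i (u t : R), u \in `[0, 1] -> t \in `]0, 1[ ->
  is_derive t 1 (phi i u) (u * (c i q u t - c i p u t)).
Hypothesis phi_u : forall i (u t : R), u \in `]0, 1[ -> t \in `]0, 1[ ->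
  is_derive u 1 (phi i ^~ t)
    ((1 - t) * c i p u t + t * c i q u t - c i o u t).
Hypothesis c_sym : forall i j (u t : R), u \in `[0, 1] -> t \in `[0, 1] ->
  c i j u t - phi i u t = c j i u t - phi j u t.

(* Poincare lemma in polar coordinates: [D du + u E dt] is the pull-back of a
   closed form, and its integral over the boundary of the unit square vanishes. *)
Let D u t : R := (1 - t) * phi p u t + t * phi q u t - phi o u t.

(** The mixed derivative. The chain rule alone gives it as the [t]-derivative of [D]; it is also the
    [u]-derivative of [u E] thanks to [c_sym], and this equality is closedness. *)
Let D' u t : R := phi q u t - phi p u t +
  u * ((1 - t) * (c p q u t - c p p u t) + t * (c q q u t - c q p u t) -
       (c o q u t - c o p u t)).

Let D_continuous : continuous (fun z : R * R => D z.1 z.2).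
Proof.
apply: continuousTB => //; apply: continuousTD; apply: continuousTM => //.
  by apply: continuousTB; [exact: continuousT_cst|exact: continuousT_snd].
exact: continuousT_snd.
Qed.

Let D'_continuous : continuous (fun z : R * R => D' z.1 z.2).
Proof.
apply: continuousTD; first exact: continuousTB.
apply: continuousTM; first exact: continuousT_fst.
apply: continuousTB; last exact: continuousTB.
apply: continuousTD; apply: continuousTM; try exact: continuousTB.
  by apply: continuousTB; [exact: continuousT_cst|exact: continuousT_snd].
exact: continuousT_snd.
Qed.

Let D_derive (u t : R) : u \in `[0, 1] -> t \in `]0, 1[ -> is_derive t 1 (D u) (D' u t).
Proof.
move=> u01 t01; have d i := phi_t i u01 t01.
have -> : D u = (cst 1 - id) * phi p u + id * phi q u - phi o u by [].
apply: is_derive_eq.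
transitivity ((1 - t) * (u * (c p q u t - c p p u t)) + phi p u t * (0 - 1) +
  (t * (u * (c q q u t - c q p u t)) + phi q u t * 1) -
  u * (c o q u t - c o p u t)) => //.
rewrite /D'; ring.
Qed.

Let uE_derive (u t : R) : u \in `]0, 1[ -> t \in `]0, 1[ ->
  is_derive u 1 (fun u => u * (phi q u t - phi p u t)) (D' u t).
Proof.
move=> u01 t01; have d i := phi_u i u01 t01.
have u01' : u \in `[0, 1] by exact: subset_itv_oo_cc.
have t01' : t \in `[0, 1] by exact: subset_itv_oo_cc.
have -> : (fun u => u * (phi q u t - phi p u t)) =
  id * ((phi q)^~ t - (phi p)^~ t) by [].
apply: is_derive_eq.
have := c_sym p q u01' t01'; have := c_sym o q u01' t01'.
have := c_sym o p u01' t01' => h1 h2 h3.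
transitivity (u * (((1 - t) * c q p u t + t * c q q u t - c q o u t) -
  ((1 - t) * c p p u t + t * c p q u t - c p o u t)) +
  (phi q u t - phi p u t) * 1) => //.
rewrite /D'; set x := (X in _ = X).
(* The two forms differ by an antisymmetric expression in [q - p] and [(1 - t) p + t q - o].
   Expanding it leaves the pairs [(p, q)], [(o, q)] and [(o, p)] with weights free of [t], and the
   [phi] terms cancel because both arguments have total mass 0. *)
have -> : x = x + u * ((c p q u t - phi p u t - (c q p u t - phi q u t)) * -1 +
  (c o q u t - phi o u t - (c q o u t - phi q u t)) -
  (c o p u t - phi o u t - (c p o u t - phi p u t))).
  by rewrite h1 h2 h3 !subrr mul0r addr0 subr0 mulr0 addr0.
rewrite /x; ring.
Qed.

(** Integrate [D] over [u]: the [t]-derivative is the integral of [D'], that is [u E] at [u = 1],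
    the factor [u] killing the edge [u = 0]. Then integrate over [t]; at [t = 1] and [t = 0], [D] is
    [phi q - phi o] and [phi p - phi o]. *)
Lemma closed_form_integral :
  \int[mu]_(u in `[0, 1]) (phi q u 1 - phi o u 1) -
  \int[mu]_(u in `[0, 1]) (phi p u 0 - phi o u 0) =
  \int[mu]_(t in `[0, 1]) (phi q 1 t - phi p 1 t).
Proof.
have E_int (t : R) : t \in `]0, 1[ ->
    \int[mu]_(u in `[0, 1]) D' u t = phi q 1 t - phi p 1 t.
  move=> t01.
  have cp i : continuous (phi i ^~ t) := continuous_slicel (@cphi i).
  have cE : continuous (fun u : R => u * (phi q u t - phi p u t)).
    by apply: continuousTM; [exact: continuousT_id|exact: continuousTB].
  have cD : continuous (D' ^~ t) := continuous_slicel D'_continuous.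
  have dE u (u01 : u \in `]0, 1[) := uE_derive u01 t01.
  by rewrite (Rintegral_derive01 cD cE dE) mul1r mul0r subr0.
have G_derive (t : R) : t \in `]0, 1[ ->
    is_derive t 1 (fun t => \int[mu]_(u in `[0, 1]) D u t) (phi q 1 t - phi p 1 t).
  move=> t01; have [M M0 DM] := bounded_on_square D'_continuous.
  have d1E (s u : R) : s \in `]0, 1[ -> u \in `[0, 1] ->
      partial1of2 (fun t u => D u t) s u = D' u s.
    by move=> s01 u01; rewrite partial1of2E; case: (D_derive u01 s01).
  have ct s : continuous (D ^~ s) := continuous_slicel D_continuous.
  have mB : measurable ([set` `[0, 1]] : set (measurableTypeR R)) by [].
  have t01' : [set` `]0%R, 1%R[] t by [].
  have it (s : R) : [set` `]0, 1[] s -> mu.-integrable [set` `[0, 1]] (EFin \o D ^~ s).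
    by move=> _; exact: (continuous_integrable_itv lebesgue01).
  have dD (s u : R) : [set` `]0, 1[] s -> [set` `[0, 1]] u ->
      derivable (fun s => D u s) s 1.
    by move=> s01 u01; case: (D_derive u01 s01).
  have iM : mu.-integrable [set` `[0, 1]] (EFin \o (fun=> M)).
    exact: (continuous_integrable_itv lebesgue01 (continuousT_cst M)).
  have ubM (s u : R) : [set` `]0, 1[] s -> [set` `[0, 1]] u ->
      `|partial1of2 (fun t u => D u t) s u| <= M.
    move=> s01 u01; rewrite d1E//; apply: DM => //.
    by apply: subset_itv_oo_cc.
  have M0' (_ : R) : 0 <= M by [].
  have dG := derivable_under_integral mB t01' it dD M0' iM ubM.
  apply: DeriveDef; first exact: dG.
  rewrite -derive1E (differentiation_under_integral mB t01' it dD M0' iM ubM).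
  rewrite -E_int//; apply: eq_Rintegral => u; rewrite inE => u01.
  by rewrite d1E.
have cE : continuous (fun t => phi q 1 t - phi p 1 t).
  have cp i : continuous (phi i 1) := continuous_slicer (@cphi i).
  exact: continuousTB.
have cG : continuous (fun t => \int[mu]_(u in `[0, 1]) D u t).
  apply: (@continuous_Rintegral _ mu 0 1 lebesgue01 _ (fun t u => D u t)).
  apply: (continuousT_comp (f := fun z : R * R => (z.2, z.1)) _ D_continuous).
  exact: continuous_pair continuousT_snd continuousT_fst.
rewrite (Rintegral_derive01 cE cG G_derive).
by congr (_ - _); apply: eq_Rintegral => u _; rewrite /D; ring.
Qed.

End closed_form.
Arguments lebesgue01 {R}.

(** * Borel sets of the plane and Fubini's theorem *)

Section product_measurability.
Variable R : realType.
Notation RR := (measurableTypeR R * measurableTypeR R)%type.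

(** An open set is the union of the rational boxes that it contains. [S a b r] is empty for the
    other boxes, so the union runs over all rational triples and is countable. *)
Lemma open_measurable_prod (A : set (R * R)) : open A -> measurable (A : set RR).
Proof.
move=> oA.
pose Q (a b r : rat) : set (R * R) :=
  ball (ratr a : R) (ratr r : R) `*` ball (ratr b : R) (ratr r : R).
pose S (a b r : rat) : set RR := [set z : R * R | Q a b r z /\ Q a b r `<=` A].
have -> : A = \bigcup_a \bigcup_b \bigcup_r S a b r.
  apply/seteqP; split => [[x y] Axy|z [a _ [b _ [r _ []]]]]; last first.
    by move=> zab; exact.
  have : nbhs (x, y) A by exact: open_nbhs_nbhs.
  move=> /nbhs_ballP[e /= e0 eA].
  (* Two points of a box of radius [r] are at distance less than [2 r] through its centre, hence the
     choice of [r] below [e / 2]. *)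
  have e20 : 0 < e / 2 by rewrite divr_gt0.
  have [r] := rat_in_itvoo e20; rewrite in_itv/= => /andP[r0 re].
  have [a] : exists a : rat, ratr a \in `]x - ratr r, x + ratr r[.
    by apply: rat_in_itvoo; rewrite ltrBlDr -addrA ltrDl addr_gt0.
  have [b] : exists b : rat, ratr b \in `]y - ratr r, y + ratr r[.
    by apply: rat_in_itvoo; rewrite ltrBlDr -addrA ltrDl addr_gt0.
  rewrite !in_itv/= => ybr xar.
  have xr : `|x - ratr a| < ratr r by rewrite distrC ltr_distl.
  have yr : `|y - ratr b| < ratr r by rewrite distrC ltr_distl.
  exists a => //; exists b => //; exists r => //; split.
    by split; rewrite /ball/= distrC.
  move=> [x' y'] [/= ax by_]; apply: eA; split; rewrite /ball/=.
    rewrite -(subrK (ratr a) x) -addrA (le_lt_trans (ler_normD _ _))//.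
    by rewrite [ltRHS]splitr ltrD// (lt_trans _ re).
  rewrite -(subrK (ratr b) y) -addrA (le_lt_trans (ler_normD _ _))//.
  by rewrite [ltRHS]splitr ltrD// (lt_trans _ re).
apply: bigcupT_measurable_rat => a; apply: bigcupT_measurable_rat => b.
apply: bigcupT_measurable_rat => r; rewrite /S.
have [sA|nA] := pselect (Q a b r `<=` A).
  rewrite (_ : [set z | _] = Q a b r); last first.
    by apply/seteqP; split => z // [].
  by apply: measurableX; exact: measurable_ball.
rewrite (_ : [set z | _] = set0)//.
by apply/seteqP; split => z // [].
Qed.

Lemma continuous_measurable_prod (g : R * R -> R) :
  continuous g -> measurable_fun setT (g : RR -> measurableTypeR R).
Proof.
move=> /continuousP cg; apply: (measurability _ (RGenOpens.measurableE R)).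
move=> _ [_ [a [b ->] <-]]; rewrite setTI; apply: open_measurable_prod.
exact/cg/interval_open.
Qed.

Lemma Rintegral_swap (m1 m2 : probability (measurableTypeR R) R)
    (g : R -> R -> R) (B : R) :
  continuous (fun z => g z.1 z.2) -> (forall x y, `|g x y| <= B) ->
  \int[m1]_x (\int[m2]_y g x y) = \int[m2]_y (\int[m1]_x g x y).
Proof.
move=> cg gB; pose f (z : RR) := (g z.1 z.2)%:E.
have mg := continuous_measurable_prod cg.
have iP d (T : measurableType d) (P : probability T R) (h : T -> R) :
    measurable_fun setT h -> (forall w, `|h w| <= B) -> P.-integrable setT (EFin \o h).
  move=> mh hB; apply: measurable_bounded_integrable => //.
    by rewrite [X in (X < _)%E]probability_setT ltry.
  exists B; split; first exact: num_real.
  by move=> M BM w _ /=; exact: le_trans (hB w) (ltW BM).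
have if_ : (m1 \x m2)%E.-integrable setT f by apply: iP => // z; exact: gB.
have i2 x : m2.-integrable setT (EFin \o g x).
  by apply: iP => //; apply: continuous_measurable_fun; exact: continuous_slicer cg.
have i1 y : m1.-integrable setT (EFin \o g ^~ y).
  by apply: iP => //; apply: continuous_measurable_fun; exact: continuous_slicel cg.
rewrite /Rintegral; congr fine; have := Fubini if_; rewrite /fubini_F/fubini_G/= => fub.
under eq_integral => x _ do rewrite fineK ?(integrable_fin_num _ (i2 x))//.
under [RHS]eq_integral => y _ do rewrite fineK ?(integrable_fin_num _ (i1 y))//.
exact: fub.
Qed.

End product_measurability.

(** * Differentiation of integrals from averaged slopes *)

Section derivative_of_integral.
Variable R : realType.
Notation mu := (@lebesgue_measure R).

(** Caratheodory's form of differentiability: [g] is the slope, extended continuously to the base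
    point. It suits slopes that are themselves integrals. *)
Lemma is_derive_caratheodory (f g : R -> R) (a : R) : continuous g ->
  (\forall x \near a, f x - f a = (x - a) * g x) -> is_derive a 1 f (g a).
Proof.
move=> cg fg.
have ha : h + a @[h --> (0 : R)] --> a.
  by rewrite -[X in _ --> X]add0r; apply: cvgD; [exact: cvg_id|exact: cvg_cst].
have cv : h^-1 *: ((f \o shift a) (h *: 1) - f a) @[h --> 0^'] --> g a.
  have cvg : g (h + a) @[h --> (0 : R)^'] --> g a.
    have : g (h + a) @[h --> (0 : R)] --> g a := cvg_comp _ g ha (cg a).
    by apply: cvg_trans; apply: cvg_app; exact: cvg_within.
  apply: cvg_trans cvg; apply: near_eq_cvg.
  rewrite near_withinE; near=> h => h0 /=.
  have -> : h *: 1 + a = h + a by rewrite [h *: 1]mulr1.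
  have -> : f (h + a) - f a = (h + a - a) * g (h + a).
    by near: h; exact: (ha _ fg).
  by rewrite addrK -[RHS]/(h^-1 * (h * g (h + a))) mulrA mulVf// mul1r.
apply: DeriveDef; first by apply/cvg_ex; exists (g a).
exact/cvg_lim.
Unshelve. all: by end_near. Qed.

Variables (m : {measure set (measurableTypeR R) -> \bar R}) (a b : R).
Hypothesis mab : (m [set` `[a, b]] < +oo)%E.

(** The slope of [h] between [r] and [r'] is the mean [G (r', x)] of [k] over the segment joining
    them. It is continuous in [(r', x)] and equals [k r x] at [r' = r]; its integral over [x] is the
    slope required by Caratheodory's form. *)
Lemma is_derive_Rintegral (h k : R -> R -> R) (r : R) :
  continuous (fun z => h z.1 z.2) -> continuous (fun z => k z.1 z.2) ->
  (forall r r' x : R, r \in `[0, 1] -> r' \in `[0, 1] -> x \in `[a, b] ->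
     h r' x - h r x =
     (r' - r) * \int[mu]_(s in `[0, 1]) k (r + s * (r' - r)) x) ->
  r \in `]0, 1[ ->
  is_derive r 1 (fun r => \int[m]_(x in [set` `[a, b]]) h r x)
                (\int[m]_(x in [set` `[a, b]]) k r x).
Proof.
move=> ch ck hk r01; have r01' : r \in `[0, 1] by exact: subset_itv_oo_cc.
pose G (z : R * R) : R := \int[mu]_(s in `[0, 1]) k (r + s * (z.1 - r)) z.2.
have cG : continuous G.
  apply: (@continuous_Rintegral _ mu 0 1 lebesgue01 _
    (fun z s => k (r + s * (z.1 - r)) z.2)).
  apply: (continuousT_comp (f := fun w : R * R * R => (r + w.2 * (w.1.1 - r), w.1.2))
    (g := fun z => k z.1 z.2)); last exact: ck.
  apply: (continuous_pair (f := fun w : R * R * R => r + w.2 * (w.1.1 - r))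
    (g := fun w => w.1.2)).
  - apply: continuousTD; first exact: continuousT_cst.
    apply: continuousTM; first exact: continuousT_snd.
    apply: continuousTB; last exact: continuousT_cst.
    exact: (continuousT_comp continuousT_fst continuousT_fst).
  - exact: (continuousT_comp continuousT_fst continuousT_snd).
have Gr x : G (r, x) = k r x.
  rewrite /G /=; under eq_Rintegral do rewrite subrr mulr0 addr0.
  by rewrite Rintegral_cst//= lebesgue_measure_itv/= lte_fin ltr01 -EFinB/= subr0 mulr1.
have cg : continuous (fun r' => \int[m]_(x in [set` `[a, b]]) G (r', x)).
  apply: (continuous_Rintegral mab (f := fun r' x => G (r', x))).
  apply: (continuousT_comp (f := fun z : R * R => (z.1, z.2))); last exact: cG.
  exact: continuous_pair continuousT_fst continuousT_snd.
have -> : \int[m]_(x in [set` `[a, b]]) k r x =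
  \int[m]_(x in [set` `[a, b]]) G (r, x) by under [RHS]eq_Rintegral do rewrite Gr.
apply: (is_derive_caratheodory cg).
have : \forall r' \near r, r' \in `]0, 1[ by exact: near_in_itvoo.
apply: filterS => r' r'01; have r'01' : r' \in `[0, 1] by exact: subset_itv_oo_cc.
rewrite -RintegralB//; last 2 first.
- by apply: continuous_integrable_itv => //; exact: continuous_slicer ch.
- by apply: continuous_integrable_itv => //; exact: continuous_slicer ch.
rewrite -RintegralZl//; last first.
  apply: continuous_integrable_itv => //.
  apply: (continuousT_comp (f := fun x => (r', x))); last exact: cG.
  exact: continuous_pair (continuousT_cst r') continuousT_id.
by apply: eq_Rintegral => x; rewrite inE => xab; rewrite hk.
Qed.

End derivative_of_integral.

(** * Integration against measures supported in a segment *)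

Section supported_measures.
Variables (R : realType) (K : R).
Hypothesis K0 : 0 < K.
Notation X := ([set` `[- K, K]] : set (measurableTypeR R)).
Implicit Types (m p q : P1 R) (f : R -> R).

(** Retraction onto [[-K, K]]: composing with it turns functions controlled only there into
    continuous functions on the whole line. *)
Definition clip (x : R) : R := Num.max (- K) (Num.min x K).

Lemma clip_itv x : clip x \in `[- K, K].
Proof.
by rewrite in_itv/= /clip le_max lexx/= ge_max ge_min lexx orbT andbT ge0_cp ?ltW.
Qed.

Lemma clip_id x : x \in `[- K, K] -> clip x = x.
Proof. by rewrite in_itv/= => /andP[Kx xK]; rewrite /clip min_l// max_r. Qed.

Lemma clip_continuous : continuous clip.
Proof.
move=> x; apply: (@continuous_max _ _ (cst (- K)) (fun x => Num.min x K)).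
  exact: cst_continuous.
by apply: (@continuous_min _ _ id (cst K)) => //; exact: cst_continuous.
Qed.

Lemma supported_lty m : (m X < +oo)%E.
Proof. by rewrite ltey_eq fin_num_measure. Qed.

Lemma continuous_integrableX m f :
  continuous f -> m.-integrable X (EFin \o f).
Proof.
by move=> cf; apply: continuous_integrable_itv => //; exact: supported_lty.
Qed.

Lemma supported_mix t p q : supported K p -> supported K q ->
  supported K (mix t p q).
Proof.
rewrite /supported/= mix_clampE => -> ->.
by rewrite !mule1 -EFinD subrK.
Qed.

Lemma supported_dirac0 : supported K (P1_dirac 0).
Proof.
by rewrite /supported/= diracE mem_set//= in_itv/= oppr_le0 (ltW K0).
Qed.

Lemma supported_Rintegral m f : supported K m -> m.-integrable setT (EFin \o f) ->
  \int[m]_(x in X) f x = \int[m]_x f x.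
Proof.
move=> mK fi; rewrite /Rintegral [in RHS](@negligible_integral _ _ _ _ _ (~` X))//.
- by rewrite setTD setCK.
- exact: measurableC.
- by rewrite [LHS]probability_setC// [X in (1 - X)%E]mK subee.
Qed.

Lemma supported_Rintegral_clip m f (B : R) : supported K m -> continuous f ->
  (forall x, `|f x| <= B) -> \int[m]_(x in X) f x = \int[m]_x f x.
Proof.
move=> mK cf fB; apply: supported_Rintegral => //.
apply: measurable_bounded_integrable => //.
- by rewrite [X in (X < _)%E]probability_setT ltry.
- exact: continuous_measurable_fun.
- exists B; split; first exact: num_real.
  by move=> M BM x _ /=; exact: le_trans (fB x) (ltW BM).
Qed.

Lemma Rintegral_mix t p q f : t \in `[0, 1] -> continuous f ->
  \int[mix t p q]_(x in X) f x =
  (1 - t) * \int[p]_(x in X) f x + t * \int[q]_(x in X) f x.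
Proof.
move=> t01 cf; have ip := continuous_integrableX p cf.
have iq := continuous_integrableX q cf.
have mf : measurable_fun X (EFin \o f).
  apply/measurable_EFinP.
  exact: measurable_funTS (continuous_measurable_fun cf).
have mX : measurable X by [].
have sc (r : {nonneg R}) m : m.-integrable X (EFin \o f) ->
    (mscale r m).-integrable X (EFin \o f).
  move=> /integrableP[_ im]; apply/integrableP; split => //.
  rewrite ge0_integral_mscale//; last exact: measurableT_comp.
  by rewrite lte_mul_pinfty.
rewrite /Rintegral.
rewrite [X in fine X](@integral_measure_add _ _ _ _ _ X mX (EFin \o f))//;
  [|exact: sc|exact: sc].
have scE (r : {nonneg R}) m : m.-integrable X (EFin \o f) ->
    (\int[mscale r m]_(x in X) (f x)%:E = (r%:num * \int[m]_(x in X) f x)%:E)%E.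
  move=> im; rewrite integralE.
  rewrite !ge0_integral_mscale//;
    [|exact: measurable_funeneg|exact: measurable_funepos].
  rewrite -muleBr//; last first.
    by apply: fin_num_adde_defl; rewrite fin_numN; exact: integrable_neg_fin_num.
  by rewrite -integralE EFinM /Rintegral fineK// integrable_fin_num.
rewrite /= !scE//= /clamp01; move: t01; rewrite in_itv/= => /andP[t0 t1].
by rewrite min_l// max_r.
Qed.

Lemma clip_bounded (g : R -> R -> R) : continuous (fun z => g z.1 z.2) ->
  (forall x y, g x y = g (clip x) (clip y)) ->
  exists B : R, forall x y, `|g x y| <= B.
Proof.
move=> cg gclip; have /compact_bounded[M [_ mrt]] :
    compact ((fun z => g z.1 z.2) @` ([set` `[- K, K]] `*` [set` `[- K, K]])).
  apply: continuous_compact; first exact: continuous_subspaceT.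
  by apply: compact_setX; exact: segment_compact.
exists (`|M| + 1) => x y; rewrite gclip.
apply: mrt; first by rewrite (le_lt_trans (ler_norm _))// ltrDl.
by exists (clip x, clip y) => //; split; exact: clip_itv.
Qed.

(** Invariance under [clip] makes [g] bounded on the plane. The bound passes to the inner integrals
    because each measure has mass 1 on the segment, so every integral extends to the line, where
    [Rintegral_swap] applies. *)
Lemma supported_swap p q (g : R -> R -> R) : supported K p -> supported K q ->
  continuous (fun z => g z.1 z.2) -> (forall x y, g x y = g (clip x) (clip y)) ->
  \int[p]_(x in X) (\int[q]_(y in X) g x y) =
  \int[q]_(y in X) (\int[p]_(x in X) g x y).
Proof.
move=> pK qK cg gclip; have [B gB] := clip_bounded cg gclip.
have csw : continuous (fun z : R * R => g z.2 z.1).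
  apply: (continuousT_comp (f := fun z : R * R => (z.2, z.1))
    (g := fun z => g z.1 z.2)); last exact: cg.
  exact: continuous_pair continuousT_snd continuousT_fst.
have bd m (h : R -> R) : supported K m -> continuous h -> (forall x, `|h x| <= B) ->
    `|\int[m]_(x in X) h x| <= B.
  move=> mK ch hB.
  rewrite (le_trans (le_normr_Rintegral _ _))//; first exact: continuous_integrableX.
  apply: (@le_trans _ _ (\int[m]_(x in X) B)).
    apply: le_Rintegral => //.
    - apply: continuous_integrableX; apply: (continuousT_comp ch).
      exact: norm_continuous.
    - by apply: continuous_integrableX; exact: continuousT_cst.
  by rewrite Rintegral_cst// [X in fine X]mK mulr1.
have ip x : continuous (g x) by exact: continuous_slicer cg.
have iq y : continuous (g^~ y) by exact: continuous_slicel cg.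
rewrite (supported_Rintegral_clip (B := B) pK); last 2 first.
- exact: (@continuous_Rintegral _ q (- K) K (supported_lty q) _ g cg).
- by move=> x; apply: bd.
rewrite (supported_Rintegral_clip (B := B) qK); last 2 first.
- exact: (@continuous_Rintegral _ p (- K) K (supported_lty p) _ (fun y x => g x y) csw).
- by move=> y; apply: bd.
under eq_Rintegral do rewrite (supported_Rintegral_clip qK (ip _) (gB _)).
under [RHS]eq_Rintegral do rewrite (supported_Rintegral_clip pK (iq _) (gB^~ _)).
exact: Rintegral_swap cg gB.
Qed.

End supported_measures.

(** * The one-form on measures with compact support *)

Section compact_support.
Variables (R : realType) (K : R).
Hypothesis K0 : 0 < K.
Notation mu := (@lebesgue_measure R).
Notation X := ([set` `[- K, K]] : set (measurableTypeR R)).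
Notation M := (supported K).
Variable H : P1 R -> R -> R.
Hypothesis H_continuous : continuous (fun z : P1 R * R => H z.1 z.2).
Hypothesis H_C11 : C11 M X H.
Hypothesis H_sym : forall (m : P1 R) (x y : R),
  M m -> x \in `[- K, K] -> y \in `[- K, K] ->
  delta M X (H^~ x) m y - H m x = delta M X (H^~ y) m x - H m y.

Let kappa (x : R) (m : P1 R) (y : R) : R := delta M X (H^~ x) m y.

Let kappaP (x : R) : X x ->
  canonical_derivative M X (H^~ x) (kappa x) /\ C01 M X (kappa x).
Proof.
move=> Xx; have [_ /(_ x Xx) C1H _ _ _] := H_C11.
exact: (xgetPex (fun _ _ => 0) C1H).
Qed.

Let X_interval : is_interval X.
Proof. exact: interval_is_interval. Qed.

(** The starting point is continuity in [m] at fixed [x] and [y]. [joint_continuity] adds the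
    variable [x], through the [x]-derivative, and then [y], through the [y]-derivative. *)
Let kappa_continuous : {within M `*` X `*` X,
  continuous (fun z : P1 R * R * R => kappa z.1.2 z.1.1 z.2)}.
Proof.
have [_ _ _ [dx cdx] cdy] := H_C11.
apply: (@joint_continuity R (P1 R * R)%type (M `*` X) X
  (fun z y => kappa z.2 z.1 y)) => //.
- move=> y Xy.
  apply: (@joint_continuity R (P1 R) M X (fun m x => kappa x m y)) => //.
  + by move=> x Xx; have [_ [_ /(_ y Xy)]] := kappaP Xx.
  + by move=> m x Mm Xx; exact: dx.
  + apply: (within_comp (B := M `*` X `*` X) (g := fun z : P1 R * R => (z, y))
      (f := fun p : P1 R * R * R =>
         derive_within X (fun x => kappa x p.1.1 p.2) p.1.2)) => //.
    exact: continuous_pair continuousT_id (continuousT_cst y).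
- move=> [m x] y [/= Mm Xx] Xy.
  by have [_ [/(_ m Mm)[/(_ y Xy)]]] := kappaP Xx.
Qed.

Variables p q : P1 R.
Hypotheses (pM : M p) (qM : M q).

Let o : P1 R := P1_dirac 0.
Let oM : M o := supported_dirac0 K0.
Let nu (u t : R) : P1 R := mix u o (mix t p q).

(** Valid for all real [u] and [t], because [mix] truncates its weight; the continuity statements
    below can thus live on the whole plane. *)
Let nuM u t : M (nu u t).
Proof. by do 2 apply: supported_mix => //. Qed.

Let nu_continuous : continuous (fun z : R * R => nu z.1 z.2).
Proof. exact: mix_dirac_continuous. Qed.

Let nuE (u t : R) A : u \in `[0, 1] -> t \in `[0, 1] -> measurable A ->
  nu u t A = ((1 - u)%:E * o A + u%:E * ((1 - t)%:E * p A + t%:E * q A))%E.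
Proof. by rewrite !in_itv/= => u01 t01 mA; rewrite /nu mixE// mixE. Qed.

Let h (u t x : R) : R := H (nu u t) (clip K x).
Let kap (u t x y : R) : R := kappa (clip K x) (nu u t) (clip K y).

Let h_continuous : continuous (fun z : R * R * R => h z.1.1 z.1.2 z.2).
Proof.
apply: (continuousT_comp (f := fun z : R * R * R => (nu z.1.1 z.1.2, clip K z.2))
  (g := fun z => H z.1 z.2)) => //.
apply: continuous_pair.
  exact: (continuousT_comp continuousT_fst nu_continuous).
exact: (continuousT_comp continuousT_snd (@clip_continuous R K)).
Qed.

Let kap_continuous :
  continuous (fun z : R * R * R * R => kap z.1.1.1 z.1.1.2 z.1.2 z.2).
Proof.
apply: (within_compT (B := M `*` X `*` X)
  (g := fun z : R * R * R * R =>
    (nu z.1.1.1 z.1.1.2, clip K z.1.2, clip K z.2)) _ _ kappa_continuous).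
  move=> z; split; last exact: clip_itv.
  by split => /=; [exact: nuM|exact: clip_itv].
have cc := @clip_continuous R K.
apply: continuous_pair; last exact: (continuousT_comp continuousT_snd cc).
apply: continuous_pair.
  apply: (continuousT_comp (f := fun z : R * R * R * R => z.1.1) _ nu_continuous).
  exact: (continuousT_comp continuousT_fst continuousT_fst).
apply: (continuousT_comp (f := fun z : R * R * R * R => z.1.2) _ cc).
exact: (continuousT_comp continuousT_fst continuousT_snd).
Qed.

Let Q (j : P1 R) (u t x : R) : R := \int[j]_(y in X) kap u t x y.

Let Q_continuous j : continuous (fun z : R * R * R => Q j z.1.1 z.1.2 z.2).
Proof.
exact: (@continuous_Rintegral _ j (- K) K (supported_lty K j) _
  (fun z y => kap z.1.1 z.1.2 z.2 y) kap_continuous).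
Qed.

Let kap_slice u t x : continuous (kap u t x).
Proof.
exact: (@continuous_slicer _ _ _ (fun z y => kap z.1.1 z.1.2 z.2 y) (u, t, x)
  kap_continuous).
Qed.

Let Q_comp j (f g : R -> R) x : continuous f -> continuous g ->
  continuous (fun s => Q j (f s) (g s) x).
Proof.
move=> cf cg.
apply: (continuousT_comp (f := fun s : R => (f s, g s, x)) _ (@Q_continuous j)).
by apply: continuous_pair; [exact: continuous_pair|exact: continuousT_cst].
Qed.

Let line_continuous (r r' : R) : continuous (fun s : R => r + s * (r' - r)).
Proof.
apply: continuousTD; first exact: continuousT_cst.
by apply: continuousTM; [exact: continuousT_id|exact: continuousT_cst].
Qed.

(* the integrand in the increment of [H] along the segment from [nu u t] to
   [nu u' t'], at the point [nu u'' t''] of parameter [s] *)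
Let increment (u t u' t' u'' t'' : R) (x s : R) :
  u \in `[0, 1] -> t \in `[0, 1] ->
  u' \in `[0, 1] -> t' \in `[0, 1] -> u'' \in `[0, 1] -> t'' \in `[0, 1] ->
  s \in `[0, 1] -> x \in `[- K, K] ->
  same_law (mix s (nu u t) (nu u' t')) (nu u'' t'') ->
  \int[nu u' t']_(y in X) kappa x (mix s (nu u t) (nu u' t')) y -
  \int[nu u t]_(y in X) kappa x (mix s (nu u t) (nu u' t')) y =
  (u - u') * Q o u'' t'' x + (u' * (1 - t') - u * (1 - t)) * Q p u'' t'' x +
  (u' * t' - u * t) * Q q u'' t'' x.
Proof.
move=> u01 t01 u01' t01' u01'' t01'' s01 xK sl.
(* The two measures agree only in law, and continuity of [kappa x] in the measure carries its values
   from one to the other. *)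
have kE y : y \in X -> kappa x (mix s (nu u t) (nu u' t')) y = kap u'' t'' x y.
  rewrite inE => Xy; rewrite /kap !clip_id//.
  apply: (@same_law_within _ M (fun m => kappa x m y)) => //.
  - by apply: supported_mix; exact: nuM.
  - by have [_ [_ /(_ y Xy)]] := kappaP xK.
rewrite (eq_Rintegral _ kE) [X in _ - X](eq_Rintegral _ kE).
have ck := @kap_slice u'' t'' x.
rewrite /nu !Rintegral_mix// -/(Q o u'' t'' x) -/(Q p u'' t'' x) -/(Q q u'' t'' x).
ring.
Qed.

Let line01 (r r' s : R) : r \in `[0, 1] -> r' \in `[0, 1] -> s \in `[0, 1] ->
  r + s * (r' - r) \in `[0, 1].
Proof.
rewrite !in_itv/= => /andP[r0 r1] /andP[r'0 r'1] /andP[s0 s1].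
by apply/andP; split; nra.
Qed.

Let H_increment m m' x : M m -> M m' -> X x -> H m' x - H m x =
  \int[mu]_(s in `[0, 1]) (\int[m']_(y in X) kappa x (mix s m m') y -
                           \int[m]_(y in X) kappa x (mix s m m') y).
Proof. by move=> Mm Mm' Xx; have [[[_ _ ->]]] := kappaP Xx. Qed.

(** At fixed [u] the coordinate line of [nu] is a segment of measures, with velocity [u (q - p)], so
    the increment formula for [H] applies along it. *)
Let h_t (u r r' x : R) : u \in `[0, 1] -> r \in `[0, 1] -> r' \in `[0, 1] ->
  x \in `[- K, K] ->
  h u r' x - h u r x = (r' - r) * \int[mu]_(s in `[0, 1])
    (u * (Q q u (r + s * (r' - r)) x - Q p u (r + s * (r' - r)) x)).
Proof.
move=> u01 r01 r01' xK; rewrite /h clip_id// H_increment//.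
rewrite -RintegralZl//; last first.
  apply: continuous_integrable_itv; first exact: lebesgue01.
  apply: continuousTM; first exact: continuousT_cst.
  by apply: continuousTB; apply: Q_comp;
    [exact: continuousT_cst|exact: line_continuous|
     exact: continuousT_cst|exact: line_continuous].
apply: eq_Rintegral => s; rewrite inE/= => s01.
rewrite (@increment u r u r' u (r + s * (r' - r)))//; [by ring|exact: line01|].
move=> A mA; rewrite mixE// !nuE//; last exact: line01.
have [x1 ->] := P1_fin o mA; have [x2 ->] := P1_fin p mA.
have [x3 ->] := P1_fin q mA.
by rewrite !(=^~ @EFinM R, =^~ @EFinD R); congr EFin; ring.
Qed.

(** The radial lines are segments too, with velocity [(1 - t) p + t q - o]. *)
Let h_u (t r r' x : R) : t \in `[0, 1] -> r \in `[0, 1] -> r' \in `[0, 1] ->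
  x \in `[- K, K] ->
  h r' t x - h r t x = (r' - r) * \int[mu]_(s in `[0, 1])
    ((1 - t) * Q p (r + s * (r' - r)) t x + t * Q q (r + s * (r' - r)) t x -
     Q o (r + s * (r' - r)) t x).
Proof.
move=> t01 r01 r01' xK; rewrite /h clip_id// H_increment//.
rewrite -RintegralZl//; last first.
  apply: continuous_integrable_itv; first exact: lebesgue01.
  have cQ (j : P1 R) : continuous (fun s : R => Q j (r + s * (r' - r)) t x).
    by apply: Q_comp; [exact: line_continuous|exact: continuousT_cst].
  apply: continuousTB => //; apply: continuousTD;
    by apply: continuousTM => //; exact: continuousT_cst.
apply: eq_Rintegral => s; rewrite inE/= => s01.
rewrite (@increment r t r' t (r + s * (r' - r)) t)//; [by ring|exact: line01|].
move=> A mA; rewrite mixE// !nuE//; last exact: line01.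
have [x1 ->] := P1_fin o mA; have [x2 ->] := P1_fin p mA.
have [x3 ->] := P1_fin q mA.
by rewrite !(=^~ @EFinM R, =^~ @EFinD R); congr EFin; ring.
Qed.

(** The index type carries the support condition, from which the symmetry of [c] draws mass 1 on
    [X]. *)
Let I := {m : P1 R | M m}.
Let phi (i : I) (u t : R) : R := \int[sval i]_(x in X) h u t x.
Let c (i j : I) (u t : R) : R := \int[sval i]_(x in X) Q (sval j) u t x.

Let phi_continuous i : continuous (fun z => phi i z.1 z.2).
Proof.
exact: (@continuous_Rintegral _ (sval i) (- K) K (supported_lty K _) _
  (fun z x => h z.1 z.2 x) h_continuous).
Qed.

Let c_continuous i j : continuous (fun z => c i j z.1 z.2).
Proof.
exact: (@continuous_Rintegral _ (sval i) (- K) K (supported_lty K _) _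
  (fun z x => Q (sval j) z.1 z.2 x) (@Q_continuous (sval j))).
Qed.

Let Q_slice j u t : continuous (Q j u t).
Proof.
exact: (@continuous_slicer _ _ _ (fun z x => Q j z.1 z.2 x) (u, t) (@Q_continuous j)).
Qed.

Let h_slice u t : continuous (h u t).
Proof.
exact: (@continuous_slicer _ _ _ (fun z x => h z.1 z.2 x) (u, t) h_continuous).
Qed.

Let oI : I := exist _ o oM.
Let pI : I := exist _ p pM.
Let qI : I := exist _ q qM.

Let phi_t (i : I) (u t : R) : u \in `[0, 1] -> t \in `]0, 1[ ->
  is_derive t 1 (phi i u) (u * (c i qI u t - c i pI u t)).
Proof.
move=> u01 t01.
have iX f := @continuous_integrableX R K (sval i) f.
have -> : u * (c i qI u t - c i pI u t) =
    \int[sval i]_(x in X) (u * (Q q u t x - Q p u t x)).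
  rewrite RintegralZl//; last by apply: iX; apply: continuousTB; exact: Q_slice.
  by rewrite RintegralB//; apply: iX; exact: Q_slice.
have ch : continuous (fun z : R * R => h u z.1 z.2).
  apply: (continuousT_comp (f := fun z : R * R => (u, z.1, z.2)) _ h_continuous).
  apply: continuous_pair; last exact: continuousT_snd.
  by apply: continuous_pair; [exact: continuousT_cst|exact: continuousT_fst].
have cQ j : continuous (fun z : R * R => Q j u z.1 z.2).
  apply: (continuousT_comp (f := fun z : R * R => (u, z.1, z.2)) _ (@Q_continuous j)).
  apply: continuous_pair; last exact: continuousT_snd.
  by apply: continuous_pair; [exact: continuousT_cst|exact: continuousT_fst].
apply: (is_derive_Rintegral (supported_lty K (sval i)) (h := h u)
  (k := fun r x => u * (Q q u r x - Q p u r x))) => //.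
- by apply: continuousTM; [exact: continuousT_cst|apply: continuousTB].
- by move=> r r' x r01 r01' xK; exact: h_t.
Qed.

Let phi_u (i : I) (u t : R) : u \in `]0, 1[ -> t \in `]0, 1[ ->
  is_derive u 1 (phi i ^~ t)
    ((1 - t) * c i pI u t + t * c i qI u t - c i oI u t).
Proof.
move=> u01 t01; have t01' : t \in `[0, 1] by exact: subset_itv_oo_cc.
have iX f := @continuous_integrableX R K (sval i) f.
have cM (a : R) j : continuous (fun x => a * Q j u t x).
  by apply: continuousTM; [exact: continuousT_cst|exact: Q_slice].
have -> : (1 - t) * c i pI u t + t * c i qI u t - c i oI u t =
    \int[sval i]_(x in X) ((1 - t) * Q p u t x + t * Q q u t x - Q o u t x).
  rewrite RintegralB//;
    [|by apply: iX; exact: continuousTD|by apply: iX; exact: Q_slice].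
  rewrite RintegralD//; [|exact: iX|exact: iX].
  by rewrite !RintegralZl//; apply: iX; exact: Q_slice.
have ch : continuous (fun z : R * R => h z.1 t z.2).
  apply: (continuousT_comp (f := fun z : R * R => (z.1, t, z.2)) _ h_continuous).
  apply: continuous_pair; last exact: continuousT_snd.
  by apply: continuous_pair; [exact: continuousT_fst|exact: continuousT_cst].
have cQ j : continuous (fun z : R * R => Q j z.1 t z.2).
  apply: (continuousT_comp (f := fun z : R * R => (z.1, t, z.2)) _ (@Q_continuous j)).
  apply: continuous_pair; last exact: continuousT_snd.
  by apply: continuous_pair; [exact: continuousT_fst|exact: continuousT_cst].
apply: (is_derive_Rintegral (supported_lty K (sval i)) (h := h ^~ t)
  (k := fun r x => (1 - t) * Q p r t x + t * Q q r t x - Q o r t x)) => //.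
- by apply: continuousTB => //; apply: continuousTD; apply: continuousTM => //;
    exact: continuousT_cst.
- by move=> r r' x r01 r01' xK; exact: h_u.
Qed.

(** Since [j] has mass 1 on [X], [phi i] is also a double integral; the common integrand is then the
    expression that [H_sym] declares symmetric. *)
Let c_phi i j u t : c i j u t - phi i u t =
  \int[sval i]_(x in X) \int[sval j]_(y in X) (kap u t x y - h u t x).
Proof.
rewrite /c /phi -RintegralB//; last 2 first.
- by apply: continuous_integrableX; exact: Q_slice.
- by apply: continuous_integrableX; exact: h_slice.
apply: eq_Rintegral => x _; rewrite RintegralB//; last 2 first.
- by apply: continuous_integrableX; exact: kap_slice.
- by apply: continuous_integrableX; exact: continuousT_cst.
by rewrite Rintegral_cst// [X in fine X](svalP j) mulr1.
Qed.

Let c_sym (i j : I) (u t : R) : u \in `[0, 1] -> t \in `[0, 1] ->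
  c i j u t - phi i u t = c j i u t - phi j u t.
Proof.
move=> u01 t01; rewrite !c_phi.
rewrite (@supported_swap _ K K0 _ _ (fun x y => kap u t x y - h u t x)
  (svalP i) (svalP j)).
- apply: eq_Rintegral => y _; apply: eq_Rintegral => x _.
  by rewrite /kap /h; apply: H_sym; [exact: nuM|exact: clip_itv..].
- apply: continuousTB.
    apply: (continuousT_comp (f := fun z : R * R => (u, t, z.1, z.2)) _ kap_continuous).
    apply: continuous_pair; last exact: continuousT_snd.
    by apply: continuous_pair; [exact: continuousT_cst|exact: continuousT_fst].
  exact: (continuousT_comp continuousT_fst (@h_slice u t)).
- by move=> x y; rewrite /kap /h !(clip_id (clip_itv _ _)).
Qed.

Lemma potential_increment :
  (forall m m' : P1 R, m.-integrable setT (EFin \o H m')) ->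
  \int[mu]_(t in `[0, 1]) (\int[q]_x H (mix t (P1_dirac 0) q) x -
    (\int[P1_dirac 0]_x H (mix t (P1_dirac 0) q) x)) -
  (\int[mu]_(t in `[0, 1]) (\int[p]_x H (mix t (P1_dirac 0) p) x -
    (\int[P1_dirac 0]_x H (mix t (P1_dirac 0) p) x))) =
  \int[mu]_(t in `[0, 1])
    (\int[q]_x H (mix t p q) x - (\int[p]_x H (mix t p q) x)).
Proof.
move=> Hi.
have phiE (i : I) (u t : R) m : same_law (nu u t) m ->
    phi i u t = \int[sval i]_x H m x.
  move=> num; rewrite /phi -(supported_Rintegral (svalP i) (Hi _ _)).
  apply: eq_Rintegral => x; rewrite inE/= => xK; rewrite /h clip_id//.
  apply: (@same_law_continuous _ (H ^~ x)) => //.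
  exact: continuous_slicel H_continuous.
have in0 : (0 : R) \in `[0, 1] by rewrite in_itv/= lexx ler01.
have in1 : (1 : R) \in `[0, 1] by rewrite in_itv/= lexx ler01.
have law A (a b : P1 R) (s : R) : s \in `[0, 1] -> measurable A ->
    mix s a b A = ((1 - s)%:E * a A + s%:E * b A)%E.
  by rewrite in_itv/= => s01 mA; rewrite mixE.
(* The edges [t = 1], [t = 0] and [u = 1] of the square are, in law, the three sides of the
   triangle. *)
have nu_t1 (u : R) : u \in `[0, 1] -> same_law (nu u 1) (mix u (P1_dirac 0) q).
  by move=> u01 A mA; rewrite nuE// law// subrr mul0e mul1e add0e.
have nu_t0 (u : R) : u \in `[0, 1] -> same_law (nu u 0) (mix u (P1_dirac 0) p).
  by move=> u01 A mA; rewrite nuE// law// subr0 mul0e mul1e adde0.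
have nu_u1 (t : R) : t \in `[0, 1] -> same_law (nu 1 t) (mix t p q).
  by move=> t01 A mA; rewrite nuE// law// subrr mul0e mul1e add0e.
have e1 : \int[mu]_(u in `[0, 1]) (phi qI u 1 - phi oI u 1) =
    \int[mu]_(u in `[0, 1]) (\int[q]_x H (mix u (P1_dirac 0) q) x -
      (\int[P1_dirac 0]_x H (mix u (P1_dirac 0) q) x)).
  apply: eq_Rintegral => u; rewrite inE/= => u01.
  by rewrite (phiE qI _ _ _ (nu_t1 u u01)) (phiE oI _ _ _ (nu_t1 u u01)).
have e0 : \int[mu]_(u in `[0, 1]) (phi pI u 0 - phi oI u 0) =
    \int[mu]_(u in `[0, 1]) (\int[p]_x H (mix u (P1_dirac 0) p) x -
      (\int[P1_dirac 0]_x H (mix u (P1_dirac 0) p) x)).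
  apply: eq_Rintegral => u; rewrite inE/= => u01.
  by rewrite (phiE pI _ _ _ (nu_t0 u u01)) (phiE oI _ _ _ (nu_t0 u u01)).
rewrite -e1 -e0.
rewrite (closed_form_integral phi_continuous c_continuous phi_t phi_u c_sym).
apply: eq_Rintegral => t; rewrite inE/= => t01.
by rewrite (phiE qI _ _ _ (nu_u1 t t01)) (phiE pI _ _ _ (nu_u1 t t01)).
Qed.

End compact_support.

(** * Removal of the support condition *)

Section limit.
Variable R : realType.
Notation mu := (@lebesgue_measure R).
Implicit Types (m p q : P1 R) (s t x : R).

Lemma supported_push s p : 0 < s -> supported s^-1 (push s p).
Proof.
move=> s0; rewrite /supported/= /distribution/pushforward.
rewrite (_ : _ @^-1` _ = setT) ?probability_setT//.
apply/seteqP; split => x //= _.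
by rewrite in_itv/= -ler_norml norm_squash_le_inv.
Qed.

Lemma push_dirac0 s : same_law (push s (P1_dirac 0)) (P1_dirac 0).
Proof.
move=> A mA; rewrite pushE /= !diracE; congr ((nat_of_bool _)%:R%:E).
by apply/idP/idP; rewrite !inE/= squash_at0.
Qed.

Lemma integrable_affine m (C : R) :
  m.-integrable setT (fun x : measurableTypeR R => (C * (1 + `|x|))%:E).
Proof.
under eq_fun do rewrite EFinM EFinD.
apply: integrableZl => //; apply: integrableD => //; last exact: integrable_norm.
apply/integrableP; split; first exact: measurable_cst.
by rewrite integral_cst// [X in (_ * X < _)%E]probability_setT mule1 ltry.
Qed.

Lemma sublinear_integrable m (f : R -> R) (C : R) : continuous f ->
  (forall x, `|f x| <= C * (1 + `|x|)) -> m.-integrable setT (EFin \o f).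
Proof.
move=> cf fC; apply: le_integrable (integrable_affine m C) => //.
  by apply/measurable_EFinP; exact: continuous_measurable_fun.
by move=> x _; rewrite lee_fin (le_trans (fC x))// ler_norm.
Qed.

Lemma continuous_Rintegral_sublinear m (f : R -> R -> R) (C a b : R) :
  continuous (fun z => f z.1 z.2) ->
  (forall r x, r \in `]a, b[ -> `|f r x| <= C * (1 + `|x|)) ->
  {in `]a, b[, continuous (fun r => \int[m]_x f r x)}.
Proof.
move=> cf fC r rab.
have rab' : r \in [set` `]a, b[] by rewrite inE.
apply: (@continuity_under_integral R _ (measurableTypeR R) m f setT _ a b
  _ _ (fun x => C * (1 + `|x|)) _ _ r rab') => //.
- move=> r' r'ab; apply: (@sublinear_integrable m _ C).
    exact: continuous_slicer cf.
  by move=> x; exact: fC.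
- by apply: aeW => x _ r' _; exact: (continuous_slicel cf).
- exact: integrable_affine.
- by move=> r' r'ab; apply: aeW => x _; exact: fC.
Qed.

(** Carries identities known for [s > 0], where push-forwards have compact support, to [s = 0],
    where they have the original laws. *)
Lemma cvg_right_eq0 (g : R -> R) : {for 0, continuous g} ->
  (forall s, s \in `]0, 1[ -> g s = 0) -> g 0 = 0.
Proof.
move=> cg g0.
have g1 : g s @[s --> 0^'+] --> g 0 by exact: cvg_at_right_filter.
have g2 : g s @[s --> 0^'+] --> (0 : R).
  apply: cvg_near_cst; near=> s; apply: g0; rewrite in_itv/=.
  by apply/andP; split; near: s; [exact: nbhs_right_gt|exact: nbhs_right_lt].
exact: (cvg_unique _ g1 g2).
Unshelve. all: by end_near. Qed.

Variable H : P1 R -> R -> R.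
Hypothesis H_C01 : C01 setT setT H.

Lemma C01_continuous : continuous (fun z : P1 R * R => H z.1 z.2).
Proof.
have [C1H cH _ cdH] := H_C01.
apply: (within_compT (B := setT `*` setT) (g := fun z : P1 R * R => z)
  (f := fun z : P1 R * R => H z.1 z.2)) => //; first exact: continuousT_id.
apply: (@joint_continuity _ _ setT setT H) => //.
by move=> m x mT xT; have [+ _] := C1H m mT; exact.
Qed.

Lemma C01_integrable m m' : m.-integrable setT (EFin \o H m').
Proof.
have [_ _ sH _] := H_C01.
have [//|C C0 HC] := sH [set m'] (@compact_set1 _ m').
apply: (@sublinear_integrable m _ C); last by move=> x; exact: HC.
exact: continuous_slicer C01_continuous.
Qed.

Lemma C01_borel : borel_measurable setT setT H.
Proof.
apply: (measurability _ (RGenOpens.measurableE R)).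
move=> _ [_ [a [b ->] <-]]; rewrite setXTT setTI; apply: sub_sigma_algebra.
by have /continuousP cH := C01_continuous; exact/cH/interval_open.
Qed.

Lemma H_same_law m m' x : same_law m m' -> H m x = H m' x.
Proof.
move=> mm'; apply: (@same_law_continuous _ (H ^~ x)) => //.
exact: continuous_slicel C01_continuous.
Qed.

Let line_integral p q := \int[mu]_(t in `[0, 1])
  (\int[q]_x H (mix t p q) x - (\int[p]_x H (mix t p q) x)).

Lemma Rintegral_same_law m m' (f : R -> R) : same_law m m' ->
  \int[m]_x f x = \int[m']_x f x.
Proof.
by move=> mm'; congr fine; apply: eq_measure_integral => A mA _; exact: mm'.
Qed.

Lemma line_integral_same_law p q p' q' : same_law p p' -> same_law q q' ->
  line_integral p q = line_integral p' q'.
Proof.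
move=> pp' qq'; apply: eq_Rintegral => t _.
rewrite (Rintegral_same_law _ pp') (Rintegral_same_law _ qq').
have e x := H_same_law x (mix_same_law t pp' qq').
by congr (_ - _); apply: eq_Rintegral => x _; exact: e.
Qed.

Variables p q : P1 R.

Let theta s t x : R := H (mix t (push s p) (push s q)) (squash s x).

Let theta_continuous : continuous (fun z : R * R * R => theta z.1.1 z.1.2 z.2).
Proof.
apply: (continuousT_comp (f := fun z : R * R * R =>
  (mix z.1.2 (push z.1.1 p) (push z.1.1 q), squash z.1.1 z.2))
  (g := fun z => H z.1 z.2)); last exact: C01_continuous.
apply: continuous_pair.
  exact: (continuousT_comp continuousT_fst (@mix_push_continuous R p q)).
apply: (continuousT_comp (f := fun z : R * R * R => (z.1.1, z.2)) _
  (@squash_continuous R)).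
apply: continuous_pair; last exact: continuousT_snd.
exact: (continuousT_comp continuousT_fst continuousT_fst).
Qed.

(** The mixtures with [(s, t)] in a rectangle form a compact set, being its continuous image. The
    other values of [t] give the same laws, by truncation. The range of [s] surrounds 0, where
    continuity is wanted. *)
Lemma sublinear_push : exists2 C : R, 0 < C & forall s t x, s \in `[- 1, 1] ->
  `|H (mix t (push s p) (push s q)) (squash s x)| <= C * (1 + `|x|).
Proof.
have [_ _ sH _] := H_C01.
pose Q := (fun z : R * R => mix z.2 (push z.1 p) (push z.1 q)) @`
  ([set` `[- 1, 1]] `*` [set` `[0, 1]]).
have cQ : compact Q.
  apply: continuous_compact.
    by apply: continuous_subspaceT; exact: mix_push_continuous.
  by apply: compact_setX; exact: segment_compact.
have [//|C C0 HC] := sH Q cQ.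
exists C => // s t x s1; have t01 : clamp01 t \in `[0, 1].
  by rewrite in_itv/= clamp01_ge0 clamp01_le1.
rewrite (@H_same_law _ (mix (clamp01 t) (push s p) (push s q))); last first.
  move=> A mA; rewrite !mix_clampE [clamp01 (clamp01 t)]clamp01_id//.
apply: (@le_trans _ _ (C * (1 + `|squash s x|))).
  by apply: HC => //; exists (s, clamp01 t).
by rewrite ler_wpM2l ?(ltW C0)// lerD2l norm_squash_le.
Qed.

Lemma Rintegral_push m (f : R -> R) s : continuous f ->
  m.-integrable setT (EFin \o (f \o squash s)) ->
  \int[push s m]_x f x = \int[m]_x f (squash s x).
Proof.
move=> cf fi; rewrite /Rintegral; congr fine.
rewrite [LHS](@integral_distribution _ _ _ _ _ m (squash_mfun s))//.
by apply/measurable_EFinP; exact: continuous_measurable_fun.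
Qed.

Let Psi m s t : R := \int[m]_x theta s t x.

(** A change of variables moves [s] from the integrating measure into the integrand, ready for
    dominated convergence. *)
Let Psi_push m s t : s \in `[- 1, 1] ->
  \int[push s m]_x H (mix t (push s p) (push s q)) x = Psi m s t.
Proof.
move=> s1; have [C C0 HC] := sublinear_push.
rewrite Rintegral_push//; first exact: continuous_slicer C01_continuous.
apply: (@sublinear_integrable m _ C); last by move=> x; exact: HC.
apply: continuousT_comp; first exact: squash_continuousr.
exact: continuous_slicer C01_continuous.
Qed.

Let itv_sub s : s \in `]- 1, 1[ -> s \in `[- 1, 1].
Proof. by apply: subset_itv_oo_cc. Qed.

Let Psi_continuous_t m s : s \in `[- 1, 1] -> continuous (Psi m s).
Proof.
move=> s1 t; have [C C0 HC] := sublinear_push.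
have t1 : t \in `]t - 1, t + 1[ by rewrite in_itv/=; apply/andP; split; lra.
apply: (@continuous_Rintegral_sublinear m (theta s) C _ _ _ _ t t1).
  apply: (continuousT_comp (f := fun z : R * R => (s, z.1, z.2)) _ theta_continuous).
  apply: continuous_pair; last exact: continuousT_snd.
  by apply: continuous_pair; [exact: continuousT_cst|exact: continuousT_fst].
by move=> r x _; exact: HC.
Qed.

Let Psi_continuous_s m t : {in `]- 1, 1[, continuous (Psi m ^~ t)}.
Proof.
have [C C0 HC] := sublinear_push.
apply: (@continuous_Rintegral_sublinear m (theta ^~ t) C).
  apply: (continuousT_comp (f := fun z : R * R => (z.1, t, z.2)) _ theta_continuous).
  apply: continuous_pair; last exact: continuousT_snd.
  by apply: continuous_pair; [exact: continuousT_fst|exact: continuousT_cst].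
by move=> r x /itv_sub r1; exact: HC.
Qed.

Let Psi_bound m : exists2 B : R, 0 <= B &
  forall s t, s \in `[- 1, 1] -> `|Psi m s t| <= B.
Proof.
have [C C0 HC] := sublinear_push.
have it s t : s \in `[- 1, 1] -> m.-integrable setT (EFin \o theta s t).
  move=> s1; apply: (@sublinear_integrable m _ C); last by move=> x; exact: HC.
  exact: (@continuous_slicer _ _ _ (fun z x => theta z.1 z.2 x) (s, t)).
exists (\int[m]_x (C * (1 + `|x|))) => [|s t s1].
  by apply: Rintegral_ge0 => x _; rewrite mulr_ge0// ltW.
rewrite (le_trans (le_normr_Rintegral _ _))//; first exact: it.
apply: le_Rintegral => //.
- by have /integrable_abse := it s t s1.
- exact: integrable_affine.
- by move=> x _; exact: HC.
Qed.

(** Dominated convergence at two levels: in [x] with the affine majorant of [sublinear_push], then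
    in [t] with the constant [Bq + Bp]. *)
Lemma line_integral_push_continuous :
  {for 0, continuous (fun s => line_integral (push s p) (push s q))}.
Proof.
have [Bp Bp0 HBp] := Psi_bound p; have [Bq Bq0 HBq] := Psi_bound q.
have i01 : mu.-integrable [set` `[0, 1]] (EFin \o (fun=> Bq + Bp)).
  apply: continuous_integrable_itv; first exact: lebesgue01.
  exact: continuousT_cst.
have s0 : 0 \in [set` `]- 1, 1[ : interval R].
  by rewrite inE/= in_itv/= ltrN10 ltr01.
have cP : {for 0, continuous (fun s => \int[mu]_(t in `[0, 1]) (Psi q s t - Psi p s t))}.
  apply: (@continuity_under_integral R _ (measurableTypeR R) mu
    (fun s t => Psi q s t - Psi p s t) [set` `[0, 1]] _ (- 1) 1 _ _
    (fun=> Bq + Bp) _ _ 0 s0) => //.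
  - move=> s /itv_sub s1; apply: continuous_integrable_itv; first exact: lebesgue01.
    by apply: continuousTB; exact: Psi_continuous_t.
  - apply: aeW => t _ s; rewrite inE => s1.
    by apply: cvgB; exact: Psi_continuous_s.
  - move=> s /itv_sub s1; apply: aeW => t _.
    by rewrite (le_trans (ler_normB _ _))// lerD// ?HBp ?HBq.
have near0 : \forall s \near (0 : R), s \in `[- 1, 1].
  have : \forall s \near (0 : R), s \in `]- 1, 1[.
    by apply: near_in_itvoo; rewrite inE in s0.
  by apply: filterS => s /itv_sub.
have E s : s \in `[- 1, 1] -> \int[mu]_(t in `[0, 1]) (Psi q s t - Psi p s t) =
    line_integral (push s p) (push s q).
  by move=> s1; apply: eq_Rintegral => t _; rewrite !Psi_push.
have in0 : 0 \in (`[- 1, 1] : interval R) by exact: nbhs_singleton near0.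
rewrite /prop_for /continuous_at -(E 0 in0); apply: cvg_trans cP; apply: near_eq_cvg.
by apply: filterS near0 => s /E.
Qed.

(** Serves the canonical condition: when [p = q], the mixture of weight 0 has the law of
    [push s p]. *)
Lemma Rintegral_push_continuous :
  {for 0, continuous (fun s => \int[push s q]_x H (mix 0 (push s p) (push s q)) x)}.
Proof.
have s0 : (0 : R) \in `]- 1, 1[ by rewrite in_itv/= ltrN10 ltr01.
have near0 : \forall s \near (0 : R), s \in `[- 1, 1].
  have : \forall s \near (0 : R), s \in `]- 1, 1[ by exact: near_in_itvoo.
  by apply: filterS => s /itv_sub.
rewrite /prop_for /continuous_at Psi_push ?itv_sub//.
apply: cvg_trans (Psi_continuous_s s0); apply: near_eq_cvg.
by apply: filterS near0 => s s1; rewrite Psi_push.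
Qed.

End limit.

Theorem theorem1p9 (R : realType) (H : P1 R -> R -> R)
  (H_C01 : C01 setT setT H)
  (H_C11 : forall K : R, 0 < K -> C11 (supported K) `[- K, K] H)
  (H_mean0 : forall K : R, 0 < K -> forall m : P1 R, supported K m ->
     \int[m]_x H m x = 0)
  (H_sym : forall K : R, 0 < K -> forall (m : P1 R) (x y : R),
     supported K m -> x \in `[- K, K] -> y \in `[- K, K] ->
     delta (supported K) `[- K, K] (H^~ x) m y - H m x =
     delta (supported K) `[- K, K] (H^~ y) m x - H m y) :
  let F := fun m : P1 R =>
    \int[lebesgue_measure]_(t in `[0, 1])
      (\int[m]_x H (mix t (P1_dirac 0) m) x -
       \int[P1_dirac 0]_x H (mix t (P1_dirac 0) m) x) in
  canonical_derivative setT setT F H.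
Proof.
move=> F; pose o : P1 R := P1_dirac 0.
pose L (p q : P1 R) := \int[lebesgue_measure]_(t in `[0, 1])
  (\int[q]_x H (mix t p q) x - (\int[p]_x H (mix t p q) x)).
have L_same := line_integral_same_law H_C01.
have L_push p q := @line_integral_push_continuous R H H_C01 p q.
split; first split.
- exact: C01_borel.
- by have [_ _ ? _] := H_C01.
- move=> q p _ _; apply/eqP; rewrite -subr_eq0; apply/eqP.
  rewrite -[LHS]/(L o q - L o p - L p q).
  (* The defect in the triangle identity after squashing. It vanishes for [s > 0] by the Poincare
     lemma, and [g 0] is the original defect because [push 0] keeps laws. *)
  pose g s := L (push s o) (push s q) - L (push s o) (push s p) -
    L (push s p) (push s q).
  have -> : L o q - L o p - L p q = g 0.
    rewrite /g /L (L_same _ _ _ _ (push0 o) (push0 q)).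
    rewrite (L_same _ _ _ _ (push0 o) (push0 p)).
    by rewrite (L_same _ _ _ _ (push0 p) (push0 q)).
  apply: cvg_right_eq0.
    by apply: cvgB; [apply: cvgB|]; exact: L_push.
  move=> s; rewrite in_itv/= => /andP[s0 _].
  have sV : 0 < s^-1 by rewrite invr_gt0.
  (* [squash s] fixes 0, so the vertex [o] stays in place, as [potential_increment] requires; its
     [K] is [s^-1]. *)
  have oo : same_law (push s o) o by exact: push_dirac0.
  have same_refl m : @same_law R m m by [].
  rewrite /g /L (L_same _ _ _ _ oo (same_refl (push s q))).
  rewrite (L_same _ _ _ _ oo (same_refl (push s p))).
  apply/eqP; rewrite subr_eq0; apply/eqP.
  apply: (potential_increment sV (C01_continuous H_C01) (H_C11 _ sV) (H_sym _ sV)).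
  + exact: supported_push.
  + exact: supported_push.
  + exact: C01_integrable.
- move=> m _.
  (* A measure is written as a mixture with itself to fit [Rintegral_push_continuous]; hypothesis
     (ii) then extends from compact supports by the same limit. *)
  have mm s : same_law (mix 0 (push s m) (push s m)) (push s m).
    by move=> A mA; rewrite mixE ?lexx ?ler01// subr0 mul1e mul0e adde0.
  pose g s := \int[push s m]_x H (mix 0 (push s m) (push s m)) x.
  have gE s : g s = \int[push s m]_x H (push s m) x.
    by apply: eq_Rintegral => x _; exact: H_same_law (mm s).
  have -> : \int[m]_x H m x = g 0.
    rewrite gE (Rintegral_same_law _ (push0 m)).
    by apply: eq_Rintegral => x _; apply: H_same_law => // A mA; rewrite push0.
  apply: cvg_right_eq0; first exact: Rintegral_push_continuous.
  move=> s; rewrite in_itv/= => /andP[s0 _]; rewrite gE.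
  by apply: (H_mean0 s^-1); [rewrite invr_gt0|exact: supported_push].
Qed.
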